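(* Let $n\ge1$ and let $\Sigma$ be any finite set with a distinguished element $\bar\sigma\in\Sigma$. Then the posets of $\Sigma$-labeled partitions of types $A_n$, $B_n$, $C_n$ and $D_n$ (defined below) are EL-shellable.
   Context: Let $[n]=\{1,\dots,n\}$ and $[[n]]=\{1,\bar 1,\dots,n,\bar n\}$ with the involution $i\leftrightarrow\bar i$; $\bar X=\{\bar x:x\in X\}$. A $\Sigma$-labeled partition of $[[n]]$ is a set partition $\pi$ of $[[n]]$ with a set $T\subseteq\pi$ of signed blocks and an injection $f:T\to\Sigma$, such that for every block $R$ also $\bar R$ is a block, and a block $S$ satisfies $S=\bar S$ iff $S$ is signed. $\Sigma(\pi)=f(T)$; $\pi_\sigma$ is the block with sign $\sigma$ ($\pi_\sigma=\emptyset$ if $\sigma\notin\Sigma(\pi)$). Order: $\pi\preceq\psi$ iff $\pi_\sigma\subseteq\psi_\sigma$ for all $\sigma\in\Sigma(\pi)$, and for every unsigned block $R$ of $\pi$ there is a block $T$ of $\psi$ with $R\subseteq T$, $\bar R\subseteq\bar T$. $\Pi_{n,\Sigma}$ is the poset of all $\Sigma$-labeled partitions with a new maximum $\hat1$ adjoined. Type $A_n$: the subposet of $\Pi_{n,\Sigma}\setminus\{\hat1\}$ of elements with no signed blocks of the form $R_1\mid\bar R_1\mid\cdots\mid R_k\mid\bar R_k$ where $R_1\mid\cdots\mid R_k$ is a partition of $[n]$ (this is isomorphic to the lattice of set partitions of $[n]$). Type $C_n$: $\Pi_{n,\Sigma}$. Type $B_n$: the elements $x\in\Pi_{n,\Sigma}\setminus\{\hat1\}$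 with $|x_\sigma|\ne2$ for all $\sigma\ne\bar\sigma$, together with $\hat1$. Type $D_n$: the elements $x\in\Pi_{n,\Sigma}\setminus\{\hat1\}$ with $|x_\sigma|\ne2$ for all $\sigma\in\Sigma$, together with $\hat1$. A bounded poset is EL-shellable if it admits an EL-labeling: an edge labeling of its covering relations by elements of a poset such that every closed interval $[x,y]$ has a unique maximal chain with strictly increasing label word, and that chain's word lexicographically precedes those of all other maximal chains of $[x,y]$. *)

(* Defs.v *)
From HB Require Import structures.
From mathcomp Require Import all_boot all_order.

Set Implicit Arguments.
Unset Strict Implicit.
Unset Printing Implicit Defensive.

Import Order.TTheory.
Local Open Scope order_scope.

Section ELShellability.
Variables (d : Order.disp_t) (P : finPOrderType d).

Definition bounded_poset : Prop :=
  (exists b : P, forall x, b <= x) /\ (exists t : P, forall x, x <= t).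

Definition covers (x y : P) : bool := (x < y) && ~~ [exists z : P, x < z < y].

(* A maximal chain x = x_0, x_1, ..., x_k = y of the interval [x, y] is given
   by its tail c = [:: x_1; ...; x_k]. *)
Definition max_chain (x y : P) (c : seq P) : bool :=
  path covers x c && (last x c == y).

Variables (dL : Order.disp_t) (L : porderType dL).

(* Only the values lam x y with covers x y matter. *)
Definition label_word (lam : P -> P -> L) (x : P) (c : seq P) : seqlexi L :=
  pairmap lam x c.

Definition increasing_chain (lam : P -> P -> L) (x : P) (c : seq P) : bool :=
  sorted <%O (label_word lam x c : seq L).

Definition EL_labeling (lam : P -> P -> L) : Prop :=
  forall x y : P, x <= y ->
  exists c : seq P,
    [/\ max_chain x y c,
        increasing_chain lam x c,
        forall c', max_chain x y c' -> increasing_chain lam x c' -> c' = c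
      & forall c', max_chain x y c' -> c' <> c ->
          label_word lam x c < label_word lam x c'].

End ELShellability.

Definition EL_shellable (d : Order.disp_t) (P : finPOrderType d) : Prop :=
  bounded_poset P /\
  exists (dL : Order.disp_t) (L : porderType dL) (lam : P -> P -> L),
    EL_labeling lam.

(* The set [[n]]: (i, false) stands for i and (i, true) for its bar. *)
Definition dbl (n : nat) : finType := ('I_n * bool)%type.

Definition bar (n : nat) (x : dbl n) : dbl n := (x.1, ~~ x.2).

Definition barset (n : nat) (X : {set dbl n}) : {set dbl n} := @bar n @: X.

Section LabeledPartitions.
Variables (n : nat) (Sigma : finType).

(* u.1 is the set partition and u.2 encodes f : T -> Sigma, where T is the set
   of blocks R with u.2 R != None. *)
Definition is_lpart
    (u : {set {set dbl n}} * {ffun {set dbl n} -> option Sigma}) : bool :=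
  [&& partition u.1 [set: dbl n],
      [forall R, (u.2 R != None) ==> (R \in u.1)],
      [forall R, forall S, (u.2 R != None) && (u.2 R == u.2 S) ==> (R == S)],
      [forall R in u.1, barset R \in u.1]
    & [forall S in u.1, (S == barset S) == (u.2 S != None)]].

Record lpart := LPart { lpart_val; _ : is_lpart lpart_val }.

HB.instance Definition _ := [isSub for lpart_val].
HB.instance Definition _ := [Finite of lpart by <:].

Definition blocks (p : lpart) : {set {set dbl n}} := (lpart_val p).1.
Definition sign (p : lpart) (R : {set dbl n}) : option Sigma :=
  (lpart_val p).2 R.

Definition signs (p : lpart) : {set Sigma} :=
  [set s | [exists R in blocks p, sign p R == Some s]].

(* \bigcup over the at most one block with sign s; set0 if there is none. *)
Definition sblock (p : lpart) (s : Sigma) : {set dbl n} :=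
  \bigcup_(R in blocks p | sign p R == Some s) R.

Definition lpart_le (p q : lpart) : bool :=
  [forall s in signs p, sblock p s \subset sblock q s] &&
  [forall R in blocks p, (sign p R == None) ==>
     [exists T in blocks q, (R \subset T) && (barset R \subset barset T)]].

Lemma lpartP (p : lpart) :
  [/\ partition (blocks p) [set: dbl n],
      (forall R, sign p R != None -> R \in blocks p)
    & (forall R S, sign p R != None -> sign p R = sign p S -> R = S)].
Proof.
have /and5P[pu /forallP Tu /forallP injf _ _] := valP p; split=> //.
  by move=> R; apply/implyP/Tu.
move=> R S nR eRS; have /forallP/(_ S)/implyP := injf R.
by rewrite nR /= => h; apply/eqP/h/eqP.
Qed.

Lemma sblockE (p : lpart) R s : sign p R = Some s -> sblock p s = R.
Proof.
move=> sR; have [_ Tp injp] := lpartP p.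
have Rp : R \in blocks p by apply: Tp; rewrite sR.
rewrite /sblock (big_pred1 R) // => S /=; apply/andP/eqP => [[_ /eqP sS]|->].
  by apply: injp; rewrite sS.
by rewrite sR.
Qed.

Lemma signsP (p : lpart) s :
  reflect (exists2 R, R \in blocks p & sign p R = Some s) (s \in signs p).
Proof.
rewrite inE; apply: (iffP exists_inP) => -[R Rp].
  by move/eqP; exists R.
by move=> sR; exists R => //; apply/eqP.
Qed.

Lemma sblock_notin (p : lpart) s : s \notin signs p -> sblock p s = set0.
Proof.
move=> sp; rewrite /sblock big1 // => R /andP[Rp /eqP sR].
by case/signsP: sp; exists R.
Qed.

Lemma block_neq0 (p : lpart) R : R \in blocks p -> R != set0.
Proof.
have [/and3P[_ _ n0] _ _] := lpartP p.
by move=> Rp; apply: contraNneq n0 => <-.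
Qed.

Lemma block_eq (p : lpart) R S x :
  R \in blocks p -> S \in blocks p -> x \in R -> x \in S -> R = S.
Proof.
have [/and3P[_ tI _] _ _] := lpartP p => Rp Sp xR xS.
by rewrite -(def_pblock tI Rp xR) (def_pblock tI Sp xS).
Qed.

Lemma lpart_leP (p q : lpart) :
  reflect
    ((forall R s, sign p R = Some s ->
        exists2 T, sign q T = Some s & R \subset T)
     /\ (forall R, R \in blocks p -> sign p R = None ->
        exists2 T, T \in blocks q & R \subset T))
    (lpart_le p q).
Proof.
have [_ Tp _] := lpartP p.
apply: (iffP andP) => -[h1 h2]; split.
- move=> R s sR; have Rp : R \in blocks p by apply: Tp; rewrite sR.
  have sp : s \in signs p by apply/signsP; exists R.
  have := forall_inP h1 s sp; rewrite (sblockE sR) => sub.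
  have [/signsP[T _ sT]|nsq] := boolP (s \in signs q).
    by exists T; rewrite // -(sblockE sT).
  by move: sub (block_neq0 Rp); rewrite (sblock_notin nsq) subset0 => ->.
- move=> R Rp sR; have /implyP := forall_inP h2 R Rp.
  by rewrite sR => /(_ isT)/exists_inP[T Tq /andP[RT _]]; exists T.
- apply/forall_inP => s /signsP[R Rp sR]; rewrite (sblockE sR).
  by have [T sT RT] := h1 R s sR; rewrite (sblockE sT).
- apply/forall_inP => R Rp; apply/implyP => /eqP sR.
  have [T Tq RT] := h2 R Rp sR; apply/exists_inP; exists T => //.
  by rewrite RT imsetS.
Qed.

Lemma lpart_le_refl : reflexive lpart_le.
Proof. by move=> p; apply/lpart_leP; split=> [R s|R] sR; exists R. Qed.

Lemma lpart_le_trans : transitive lpart_le.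
Proof.
move=> q p r /lpart_leP[pq1 pq2] /lpart_leP[qr1 qr2].
have [_ Tr _] := lpartP r.
apply/lpart_leP; split=> [R s sR|R Rp sR].
  have [T sT RT] := pq1 R s sR; have [U sU TU] := qr1 T s sT.
  by exists U => //; apply: subset_trans TU.
have [T Tq RT] := pq2 R Rp sR.
case sT: (sign q T) => [s|].
  have [U sU TU] := qr1 T s sT; exists U; last exact: subset_trans TU.
  by apply: Tr; rewrite sU.
by have [U Ur TU] := qr2 T Tq sT; exists U => //; apply: subset_trans TU.
Qed.

Lemma lpart_le_anti : antisymmetric lpart_le.
Proof.
have sgn p q : lpart_le p q -> lpart_le q p ->
    forall R s, sign p R = Some s -> sign q R = Some s.
  move=> /lpart_leP[pq1 _] /lpart_leP[qp1 _] R s sR.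
  have [_ _ injp] := lpartP p.
  have [T sT RT] := pq1 R s sR; have [R' sR' TR'] := qp1 T s sT.
  have eR : R = R' by apply: injp; rewrite sR // sR'.
  suff -> : R = T by [].
  by apply/eqP; rewrite eqEsubset RT eR.
have blk p q : lpart_le p q -> lpart_le q p -> blocks p \subset blocks q.
  move=> pq qp; apply/subsetP => R Rp.
  have [_ Tq _] := lpartP q.
  case sR: (sign p R) => [s|]; first by apply: Tq; rewrite (sgn _ _ pq qp _ _ sR).
  have [_ /(_ R Rp sR)[T Tq' RT]] := lpart_leP _ _ pq.
  have [x xR] := set0Pn _ (block_neq0 Rp).
  case sT: (sign q T) => [s|].
    have sTp := sgn _ _ qp pq _ _ sT; have [_ Tp _] := lpartP p.
    have TB : T \in blocks p by apply: Tp; rewrite sTp.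
    by move: sR; rewrite (block_eq Rp TB xR (subsetP RT x xR)) sTp.
  have [_ /(_ T Tq' sT)[U Up TU]] := lpart_leP _ _ qp.
  have eU : R = U by apply: (block_eq Rp Up xR (subsetP TU x (subsetP RT x xR))).
  suff -> : R = T by [].
  by apply/eqP; rewrite eqEsubset RT eU.
move=> p q /andP[pq qp]; apply: val_inj.
have e1 : blocks p = blocks q by apply/eqP; rewrite eqEsubset !blk.
have e2 : (val p).2 = (val q).2.
  apply/ffunP => R; rewrite -/(sign p R) -/(sign q R).
  case sp: (sign p R) => [s|]; first by rewrite (sgn _ _ pq qp _ _ sp).
  case sq: (sign q R) => [s|] //.
  by rewrite (sgn _ _ qp pq _ _ sq) in sp.
rewrite [val p]surjective_pairing [val q]surjective_pairing e2.
by congr pair.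
Qed.

Fact lpart_display : Order.disp_t. Proof. exact: Order.Disp tt tt. Qed.

HB.instance Definition _ := Order.Le_isPOrder.Build lpart_display lpart
  lpart_le_refl lpart_le_anti lpart_le_trans.

(* Pi_{n, Sigma}: None is the adjoined maximum. *)
Definition lposet := option lpart.

HB.instance Definition _ := Finite.on lposet.

Definition lposet_le (x y : lposet) : bool :=
  match x, y with
  | _, None => true
  | None, Some _ => false
  | Some p, Some q => p <= q
  end.

Lemma lposet_le_refl : reflexive lposet_le.
Proof. by case=> /=. Qed.

Lemma lposet_le_anti : antisymmetric lposet_le.
Proof. by move=> [p|] [q|] //= /le_anti->. Qed.

Lemma lposet_le_trans : transitive lposet_le.
Proof. by move=> [q|] [p|] [r|] //=; apply: le_trans. Qed.

HB.instance Definition _ := Order.Le_isPOrder.Build lpart_display lposet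
  lposet_le_refl lposet_le_anti lposet_le_trans.

Definition unbarred (R : {set 'I_n}) : {set dbl n} := [set (i, false) | i in R].

Definition in_typeA (p : lpart) : bool :=
  [forall R in blocks p, sign p R == None] &&
  [exists rho : {set {set 'I_n}},
     partition rho [set: 'I_n] &&
     (blocks p == [set unbarred R | R in rho]
                  :|: [set barset (unbarred R) | R in rho])].

Definition in_typeB (sbar : Sigma) (x : lposet) : bool :=
  if x is Some p then [forall s, (s != sbar) ==> (#|sblock p s| != 2)]
  else true.

Definition in_typeD (x : lposet) : bool :=
  if x is Some p then [forall s, #|sblock p s| != 2] else true.

Definition typeA := {p : lpart | in_typeA p}.
Definition typeB (sbar : Sigma) := {x : lposet | in_typeB sbar x}.
Definition typeC := lposet.
Definition typeD := {x : lposet | in_typeD x}.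

HB.instance Definition _ := SubFinite.on typeA.
HB.instance Definition _ :=
  [SubChoice_isSubPOrder of typeA by <: with lpart_display].

HB.instance Definition _ (sbar : Sigma) := SubFinite.on (typeB sbar).
HB.instance Definition _ (sbar : Sigma) :=
  [SubChoice_isSubPOrder of typeB sbar by <: with lpart_display].

HB.instance Definition _ := Order.FinPOrder.on typeC.

HB.instance Definition _ := SubFinite.on typeD.
HB.instance Definition _ :=
  [SubChoice_isSubPOrder of typeD by <: with lpart_display].

End LabeledPartitions.

(* Main.v *)
Require Import Defs.
From mathcomp Require Import all_boot all_order.
From mathcomp Require Import zify.

(**
An element of [Pi_{n,Sigma}] other than the maximum is encoded by the map
sending [i] to the sign of its block, or else to the element of its block with
the smallest index; in this encoding [p <= q] means that [q] factors through [p].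
The roots of [p] are the indices fixed by its code, and a cover sends one root
[s] to a sign, to a smaller root [r] (coherent merge) or to [bar r]
(noncoherent merge). Covers are labeled by natural numbers in consecutive
ranges: [s] for a coherent merge, then the position of the sign in a list of
[Sigma] in which the signs already used come first, then [r] for a noncoherent
merge. A cover of the form [p < \hat 1] gets the second sign label, so that it
continues an increasing chain only after a sign step in first position.

Being an EL-labeling follows from a local criterion: below any [y > x] some
cover [g] of [x] has the smallest label, labels out of [g] are larger, and out
of every other cover of [x] there is a label which does not increase. The cover
[g] performs the first coherent merge available below [y], or else the sign step
in smallest position, or else the first noncoherent merge. It never leaves the
subposets of types A, B and D, except for type D with [n = 1].
*)

Set Implicit Arguments.
Unset Strict Implicit.
Unset Printing Implicit Defensive.

Import Order.TTheory.
Local Open Scope order_scope.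

(** * A local criterion for EL-labelings *)

Section Greedy.
Variables (d : Order.disp_t) (P : finPOrderType d) (lam : P -> P -> nat).

(** The comparison of labels makes the chain through [g] lexicographically least, the cover [w]
    spoils every chain through another [z], and the last clause lets the increasing chain of
    [[g, y]] be prolonged down to [x]. *)
Definition greedy (x y g : P) : Prop :=
  [/\ covers x g, g <= y,
      forall z, covers x z -> z <= y -> z <> g ->
        (lam x g < lam x z)%N /\
        exists w, [/\ covers z w, w <= y & (lam z w <= lam x z)%N]
    & forall w, covers g w -> w <= y -> (lam x g < lam g w)%N].

Lemma covers_lt (x y : P) : covers x y -> x < y.
Proof. by case/andP. Qed.

Lemma path_covers_le (x : P) c : path (@covers d P) x c -> x <= last x c.
Proof.
elim: c x => //= z c IH x /andP[/covers_lt/ltW xz /IH]; exact: le_trans.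
Qed.

Lemma max_chain_cons (x y z : P) c :
  max_chain x y (z :: c) = covers x z && max_chain z y c.
Proof. by rewrite /max_chain /= andbA. Qed.

Lemma max_chain_le (x y : P) c : max_chain x y c -> x <= y.
Proof. by case/andP=> /path_covers_le + /eqP <-. Qed.

Lemma max_chain_refl (x : P) c : max_chain x x c -> c = [::].
Proof.
case: c => // z c; rewrite max_chain_cons => /andP[/covers_lt xz /max_chain_le].
by rewrite (lt_geF xz).
Qed.

Definition EL_chain (x y : P) (c : seq P) : Prop :=
  [/\ max_chain x y c,
      increasing_chain lam x c,
      forall c', max_chain x y c' -> increasing_chain lam x c' -> c' = c
    & forall c', max_chain x y c' -> c' <> c ->
        label_word lam x c < label_word lam x c'].

Lemma increasing_chain_cons (x z : P) c :
  increasing_chain lam x (z :: c) =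
  (if c is w :: _ then (lam x z < lam z w)%N else true) &&
  increasing_chain lam z c.
Proof. by case: c. Qed.

Lemma label_word_cons (x z : P) c :
  label_word lam x (z :: c) = (lam x z :: label_word lam z c).
Proof. by []. Qed.

(** Induction on the number of elements above [x] and up to [y]. The predicate [S] records a subset
    preserved by greedy covers, so that the increasing chain stays inside it. *)
Lemma EL_chain_of_greedy (S : pred P) :
  (forall x y, x < y -> exists2 g, greedy x y g & S x -> S y -> S g) ->
  forall x y, x <= y ->
  exists2 c, EL_chain x y c & S x -> S y -> all S c.
Proof.
move=> H x y.
have [m] := ubnP #|[set t : P | x < t <= y]|; elim: m x => // m IH x ltm.
rewrite le_eqVlt => /predU1P[<-|xy].
  exists [::]; last by [].
  by split=> // [|c' /max_chain_refl-> //|c' /max_chain_refl->]; rewrite /max_chain /=.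
have {}IH z : x < z -> z <= y ->
    exists2 c, EL_chain z y c & S z -> S y -> all S c.
  move=> xz zy; apply: IH => //; rewrite -ltnS; apply: leq_trans ltm; rewrite ltnS.
  apply: proper_card; apply/properP; split.
    by apply/subsetP=> t; rewrite !inE => /andP[zt ->]; rewrite (lt_trans xz).
  by exists z; rewrite inE ?xz ?ltxx.
have [g [xg gy gA gB] gS] := H x y xy.
have [c [mc ic uc lc] Sc] := IH g (covers_lt xg) gy.
have first c' : max_chain x y c' -> exists z c1,
    [/\ c' = z :: c1, covers x z & max_chain z y c1].
  case: c' => [|z c1]; first by rewrite /max_chain /= => /eqP e; rewrite e ltxx in xy.
  by rewrite max_chain_cons => /andP[xz mz]; exists z, c1.
exists (g :: c); last first.
  by move=> Sx Sy /=; rewrite gS // Sc // gS.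
split.
- by rewrite max_chain_cons xg.
- rewrite increasing_chain_cons ic andbT; case: {ic uc lc Sc} c mc => // w c.
  by rewrite max_chain_cons => /andP[gw /max_chain_le wy]; apply: gB.
- move=> c' /first[z [c1 [-> xz mz]]]; rewrite increasing_chain_cons.
  case/andP=> i1 i2; have [eg|/eqP zg] := eqVneq z g.
    by rewrite {}eg in mz i2 *; rewrite (uc c1).
  have zy := max_chain_le mz.
  have [_ [w [zw wy lw]]] := gA z xz zy zg.
  have [cz [mcz icz ucz lcz] _] := IH z (covers_lt xz) zy.
  have [cw [mcw _ _ _] _] := IH w (lt_trans (covers_lt xz) (covers_lt zw)) wy.
  (* The tail [c1] must be the increasing chain of [[z, y]], which is lexicographically least there.
     Its first label is thus at most that of [w], hence at most that of [z], against [i1]. *)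
  have e1 := ucz c1 mz i2; rewrite {c1 mz i2}e1 in i1 *.
  have mzw : max_chain z y (w :: cw) by rewrite max_chain_cons zw.
  have [e|/eqP ne] := eqVneq (w :: cw) cz.
    by rewrite -e ltnNge lw in i1.
  case: cz mcz icz ucz lcz i1 ne => [|u cz] mcz icz ucz lcz i1 ne.
    move: (covers_lt zw); move: mcz; rewrite /max_chain /= => /eqP e.
    by rewrite e (le_gtF wy).
  have := lcz _ mzw ne; rewrite !label_word_cons ltxi_cons => /andP[+ _].
  by rewrite leEnat => /(leq_trans i1); rewrite ltnNge lw.
- move=> c' /first[z [c1 [-> xz mz]]] ne; rewrite !label_word_cons ltxi_cons.
  have [eg|/eqP zg] := eqVneq z g.
    rewrite {}eg in mz ne *; rewrite lexx /=; apply: lc => // e.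
    by rewrite e in ne.
  have [lt _] := gA z xz (max_chain_le mz) zg.
  by rewrite leEnat (ltnW lt) leqNgt lt.
Qed.

End Greedy.

(** A cover in [Q] is a cover in [P]: the greedy cover below its upper end lies in the image of [f],
    hence is that end. So the maximal chains of [Q] are those of [P] inside [S], and the increasing
    chain of each interval is among them. *)
Lemma EL_labeling_embed (d d' : Order.disp_t) (P : finPOrderType d)
    (Q : finPOrderType d') (f : Q -> P) (S : pred P) (lam : P -> P -> nat) :
  {mono f : x y / x <= y} ->
  (forall x, S x <-> exists x', x = f x') ->
  (forall x y, x < y -> exists2 g, greedy lam x y g & S x -> S y -> S g) ->
  EL_labeling (fun x y => lam (f x) (f y)).
Proof.
move=> fle Sf H x y xy.
have flt : {mono f : x y / x < y} by apply: leW_mono.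
have Sim z : S (f z) by apply/Sf; exists z.
have fcov z w : covers z w = covers (f z) (f w).
  apply/idP/idP => [cv|/andP[]]; last first.
    rewrite flt => zw /existsPn nex; rewrite /covers zw; apply/existsPn => t.
    by have := nex (f t); rewrite !flt.
  have [g [zg gw _ _] Sg] : exists2 g, greedy lam (f z) (f w) g &
      S (f z) -> S (f w) -> S g by apply: H; rewrite flt covers_lt.
  have /Sf[g' eg] := Sg (Sim _) (Sim _); rewrite {}eg fle in zg gw *.
  move: gw; rewrite le_eqVlt => /predU1P[<- //|gw].
  case/andP: cv => _ /existsPn/(_ g'); rewrite gw andbT.
  by rewrite -flt covers_lt.
have fmax z w c : max_chain z w c = max_chain (f z) (f w) (map f c).
  by elim: c z => [|t c IH] z;
    rewrite ?max_chain_cons ?fcov ?IH // /max_chain /= (inj_eq (inc_inj fle)).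
have flab z c : label_word (fun x y => lam (f x) (f y)) z c
    = label_word lam (f z) (map f c).
  by elim: c z => // t c IH z; rewrite map_cons !label_word_cons IH.
have [c [mc ic uc lc] Sc] := EL_chain_of_greedy H (etrans (fle x y) xy).
have [c0 ec] : exists c0, c = map f c0.
  have {}Sc := Sc (Sim _) (Sim _).
  elim: {mc ic uc lc} c Sc => [|z c IH] /=; first by exists [::].
  case/andP=> /Sf[z' ->] /IH[c0 ->]; by exists (z' :: c0).
rewrite {}ec {Sc c} in mc ic uc lc *.
exists c0; split.
- by rewrite fmax.
- by rewrite /increasing_chain flab.
- move=> c'; rewrite fmax /increasing_chain flab => mc' ic'.
  exact: (inj_map (inc_inj fle)) (uc _ mc' ic').
- move=> c'; rewrite fmax !flab => mc' ne; apply: lc => // e.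
  by apply: ne; apply: (inj_map (inc_inj fle)).
Qed.

Lemma EL_shellable_nat (d : Order.disp_t) (P : finPOrderType d)
    (lam : P -> P -> nat) :
  bounded_poset P -> EL_labeling lam -> EL_shellable P.
Proof.
by move=> bP EL; split=> //; exact: ex_intro _ _ (ex_intro _ _ (ex_intro _ lam EL)).
Qed.

(** * Codes of labeled partitions *)

Section Codes.
Variables (n : nat) (Sigma : finType).

Implicit Types (p q z : lpart n Sigma) (x y : dbl n) (i r s : 'I_n).

Definition code := (dbl n + Sigma)%type.

Definition flip (v : code) : code :=
  match v with inl x => inl (bar x) | inr t => inr t end.

Definition twist (b : bool) (v : code) : code := if b then flip v else v.

(** The extension of [c] that commutes with the bar. A sign is its own bar because a signed block
    equals its bar. *)
Definition ext (c : 'I_n -> code) (v : code) : code :=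
  match v with inl x => twist x.2 (c x.1) | inr t => inr t end.

(** These conditions characterize the codes of labeled partitions, by [pcode_canonical] and
    [decode]. *)
Definition canonical (c : 'I_n -> code) : Prop :=
  forall i x, c i = inl x -> (x.1 <= i)%N /\ c x.1 = inl (x.1, false).

Lemma barK : involutive (@bar n).
Proof. by case=> i b; rewrite /bar /= negbK. Qed.

Lemma flipK : involutive flip.
Proof. by case=> [x|t] //=; rewrite barK. Qed.

Lemma twist_inr b t : twist b (inr t) = inr t.
Proof. by case: b. Qed.

Lemma ext_flip c v : ext c (flip v) = flip (ext c v).
Proof. by case: v => [[i []]|t] //=; rewrite flipK. Qed.

Lemma ext_twist c b v : ext c (twist b v) = twist b (ext c v).
Proof. by case: b => //=; rewrite ext_flip. Qed.

Lemma mem_barset (X : {set dbl n}) x : (x \in barset X) = (bar x \in X).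
Proof.
by rewrite -{1}(barK x) mem_imset //; exact: inv_inj barK.
Qed.

(** The minimum is unambiguous: an unsigned block never contains both [y] and [bar y], so its
    elements have distinct indices. *)
Definition pcode_dbl p x : code :=
  if sign p (pblock (blocks p) x) is Some t then inr t
  else inl [arg min_(y < x in pblock (blocks p) x) (y.1 : nat)].

Definition pcode p i : code := pcode_dbl p (i, false).

Lemma cover_blocks p : cover (blocks p) = setT.
Proof. by have [/cover_partition] := lpartP p. Qed.

Lemma tI_blocks p : trivIset (blocks p).
Proof. by have [/partition_trivIset] := lpartP p. Qed.

Lemma mem_block p x : x \in pblock (blocks p) x.
Proof. by rewrite mem_pblock cover_blocks inE. Qed.

Lemma block_in p x : pblock (blocks p) x \in blocks p.
Proof. by rewrite pblock_mem // cover_blocks inE. Qed.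

Lemma blockE p R x : R \in blocks p -> x \in R -> pblock (blocks p) x = R.
Proof. exact/def_pblock/tI_blocks. Qed.

Lemma same_blockE p x y :
  (pblock (blocks p) x == pblock (blocks p) y) = (y \in pblock (blocks p) x).
Proof. by rewrite eq_pblock ?tI_blocks // cover_blocks inE. Qed.

Lemma barset_block p x :
  barset (pblock (blocks p) x) = pblock (blocks p) (bar x).
Proof.
have /and5P[_ _ _ /forall_inP h _] := valP p.
apply/esym/blockE; first exact/h/block_in.
by rewrite mem_barset barK mem_block.
Qed.

Lemma block_signed p x :
  (sign p (pblock (blocks p) x) != None) = (bar x \in pblock (blocks p) x).
Proof.
have /and5P[_ _ _ _ /forall_inP h] := valP p.
rewrite -same_blockE -barset_block; exact: esym (eqP (h _ (block_in p x))).
Qed.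

Variant pcode_spec p x : code -> Prop :=
| PcodeSigned t of sign p (pblock (blocks p) x) = Some t : pcode_spec p x (inr t)
| PcodeUnsigned y of sign p (pblock (blocks p) x) = None
    & y \in pblock (blocks p) x
    & (forall y', y' \in pblock (blocks p) x -> (y.1 <= y'.1)%N) :
    pcode_spec p x (inl y).

Lemma pcodeP p x : pcode_spec p x (pcode_dbl p x).
Proof.
rewrite /pcode_dbl; case e: (sign _ _) => [t|]; first exact: PcodeSigned.
set m := (X in inl X).
have : extremum_spec leq (fun y => y \in pblock (blocks p) x)
    (fun y : dbl n => y.1 : nat) m by exact/arg_minnP/mem_block.
by case=> y yin ymin; apply: PcodeUnsigned.
Qed.

Lemma bar_notin p x y : sign p (pblock (blocks p) x) = None ->
  y \in pblock (blocks p) x -> bar y \notin pblock (blocks p) x.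
Proof.
move=> e; rewrite -same_blockE => /eqP eb; rewrite eb in e *.
by rewrite -block_signed e.
Qed.

Lemma dbl_eq x y : x.1 = y.1 -> x = y \/ x = bar y.
Proof.
case: x y => [i b] [j b'] /= ->; rewrite /bar /=.
by case: b b' => -[]; auto.
Qed.

(** For signed blocks this is injectivity of the labeling, for unsigned ones uniqueness of the
    minimum. *)
Lemma pcode_eq p x y :
  (pcode_dbl p x == pcode_dbl p y) = (y \in pblock (blocks p) x).
Proof.
apply/eqP/idP; last first.
  rewrite -same_blockE => /eqP eb.
  case: pcodeP; rewrite eb; case: pcodeP => [t ->|x' e x'in x'min].
  - by move=> t' [->].
  - by rewrite e.
  - by [].
  move=> y' _ y'in y'min.
  have /dbl_eq[->//|ex] : y'.1 = x'.1.
    by apply/ord_inj/anti_leq; rewrite y'min ?x'min.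
  by case/negP: (bar_notin e x'in); rewrite -ex.
rewrite -same_blockE.
case: pcodeP => [t e|x' e xx' _]; case: pcodeP => [t' e'|y' e' yy' _] //.
  move=> [ett]; have [_ _ inj] := lpartP p.
  by apply/eqP; apply: inj; rewrite e // e' ett.
move=> [exy]; rewrite -exy in yy'.
by move: xx' yy'; rewrite -!same_blockE => /eqP -> /eqP ->.
Qed.

(** The bar maps blocks to blocks and preserves indices, so the minima of the two blocks have the
    same index and are barred versions of each other. *)
Lemma pcode_bar p x : pcode_dbl p (bar x) = flip (pcode_dbl p x).
Proof.
have key y : (y \in pblock (blocks p) (bar x)) = (bar y \in pblock (blocks p) x).
  by rewrite -barset_block mem_barset.
case: (pcodeP p x) => [t e|x' e xx' xmin] /=.
  have : bar x \in pblock (blocks p) x by rewrite -block_signed e.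
  by rewrite -pcode_eq => /eqP <-; rewrite /pcode_dbl e.
have nbx : bar x \notin pblock (blocks p) x by rewrite -block_signed e.
case: pcodeP => [t e'|y e' yx ymin].
  have : bar (bar x) \in pblock (blocks p) (bar x) by rewrite -block_signed e'.
  by rewrite key barK => h; rewrite h in nbx.
have /dbl_eq[eyx|-> //] : y.1 = x'.1.
  apply/ord_inj/anti_leq; rewrite (xmin (bar y)) ?andbT -?key //.
  by rewrite (ymin (bar x')) // key barK.
by have := bar_notin e xx'; rewrite -eyx -key yx.
Qed.

Lemma pcode_ext p x : ext (pcode p) (inl x) = pcode_dbl p x.
Proof. by case: x => i [] //=; rewrite /pcode -pcode_bar. Qed.

Lemma pcode_idem p x y : pcode_dbl p x = inl y -> pcode_dbl p y = inl y.
Proof.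
move=> e; rewrite -[RHS]e; apply/eqP; rewrite eq_sym pcode_eq.
by case: pcodeP e => // z _ zin _ [<-].
Qed.

Lemma pcode_canonical p : canonical (pcode p).
Proof.
move=> i x e; split.
  move: e; rewrite /pcode; case: pcodeP => // z _ zin zmin [<-].
  exact: (zmin _ (mem_block p _)).
have := pcode_idem e; case: x {e} => r [] // h.
by rewrite /pcode -[(r, false)]/(bar (r, true)) pcode_bar h.
Qed.

Lemma pcode_inr p x t :
  (pcode_dbl p x == inr t) = (sign p (pblock (blocks p) x) == Some t).
Proof. by case: pcodeP => [t' ->|y ->]. Qed.

(** If blocks of [p] lie inside blocks of [q], an element and its representative in [p] have the
    same code in [q]. Conversely, the factorization turns equal codes in [p] into equal codes in
    [q], which is containment of blocks, and it preserves signs. *)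
Lemma le_pcode p q :
  reflect (forall i, ext (pcode q) (pcode p i) = pcode q i) (p <= q).
Proof.
apply: (iffP idP) => [/lpart_leP[h1 h2]|h].
  have sub x y : y \in pblock (blocks p) x -> y \in pblock (blocks q) x.
    case e: (sign p (pblock (blocks p) x)) => [t|].
      have [T sT /subsetP RT] := h1 _ _ e; have [_ Tq _] := lpartP q.
      have TB : T \in blocks q by apply: Tq; rewrite sT.
      by rewrite (blockE TB (RT x (mem_block p x))); apply: RT.
    have [T Tq /subsetP RT] := h2 _ (block_in p x) e.
    by rewrite (blockE Tq (RT x (mem_block p x))); apply: RT.
  move=> i; rewrite /pcode; case: (pcodeP p) => [t e|y e yin _].
    have [T sT /subsetP RT] := h1 _ _ e.
    have [_ Tq _] := lpartP q; have TB : T \in blocks q by apply: Tq; rewrite sT.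
    by apply/esym/eqP; rewrite pcode_inr (blockE TB (RT _ (mem_block p _))) sT.
  by rewrite pcode_ext; apply/esym/eqP; rewrite pcode_eq sub.
have {}h x : ext (pcode q) (pcode_dbl p x) = pcode_dbl q x.
  by rewrite -!pcode_ext /= ext_twist h.
apply/lpart_leP; split=> [R t sR|R Rp sR].
  have [_ Tp _] := lpartP p; have Rp : R \in blocks p by apply: Tp; rewrite sR.
  have eR y : y \in R -> sign q (pblock (blocks q) y) = Some t.
    move=> yR; apply/eqP; rewrite -pcode_inr -h.
    have /eqP -> // : pcode_dbl p y == inr t.
    by rewrite pcode_inr (blockE Rp) ?sR.
  have [x xR] := set0Pn _ (block_neq0 Rp).
  exists (pblock (blocks q) x); first exact: eR.
  apply/subsetP=> y yR; rewrite -pcode_eq.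
  by rewrite /pcode_dbl !eR.
have [x xR] := set0Pn _ (block_neq0 Rp).
exists (pblock (blocks q) x); first exact: block_in.
apply/subsetP=> y yR; rewrite -pcode_eq -!h.
suff /eqP -> : pcode_dbl p x == pcode_dbl p y by [].
by rewrite pcode_eq (blockE Rp).
Qed.

Lemma pcode_inj p q : pcode p =1 pcode q -> p = q.
Proof.
move=> e; apply: le_anti; apply/andP; split; apply/le_pcode => i.
  by rewrite e; have /le_pcode := lexx q; apply.
by rewrite -e; have /le_pcode := lexx p; apply.
Qed.

(** * From canonical maps back to labeled partitions *)

Section Decode.
Variables (c : 'I_n -> code) (can_c : canonical c).

Let C x := ext c (inl x).
Let cls x := [set y | C y == C x].
Let blks := [set cls x | x in [set: dbl n]].
Let sgn := [ffun R => if R \in blks then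
   if [pick x in R] is Some x then if C x is inr t then Some t else None
   else None else None].

Lemma ext_bar x : C (bar x) = flip (C x).
Proof. by rewrite -ext_flip. Qed.

Lemma ext_canonical x y : C x = inl y -> C y = inl y /\ (y.1 <= x.1)%N.
Proof.
case: x => i b; rewrite /C /=.
case e: (c i) => [z|t]; last by case: b.
have [le1 e1] := can_c e.
by case: b => /= -[<-] /=; rewrite e1 le1; case: z {le1 e e1} => r [].
Qed.

Lemma sgn_cls x : sgn (cls x) = if C x is inr t then Some t else None.
Proof.
rewrite ffunE imset_f ?inE //; case: pickP => [y|/(_ x)].
  by rewrite inE => /eqP ->.
by rewrite inE eqxx.
Qed.

(** A fibre of [C] equals its bar exactly when [flip] fixes its value, that is when the value is a
    sign; so the fibres over signs can serve as signed blocks. *)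
Lemma decode_proof : is_lpart (blks, sgn).
Proof.
have eb : blks = preim_partition C [set: dbl n].
  by apply: eq_imset => x /=; apply/setP=> y; rewrite !inE eq_sym.
apply/and5P; split=> /=.
- rewrite eb; exact: preim_partitionP.
- by apply/forallP=> R; rewrite ffunE; case: ifP => // _; rewrite implybT.
- apply/forallP=> R; apply/forallP=> T; apply/implyP=> /andP[nR /eqP eRT].
  have Rb : R \in blks by move: nR; rewrite ffunE; case: ifP.
  have Tb : T \in blks by move: nR; rewrite eRT ffunE; case: ifP.
  case/imsetP: Rb nR eRT => x _ ->; case/imsetP: Tb => y _ ->.
  rewrite !sgn_cls; case ex: (C x) => [//|t] _; case ey: (C y) => [//|t'] [et].
  by apply/eqP/setP=> w; rewrite !inE ex ey et.
- apply/forall_inP=> R /imsetP[x _ ->]; apply/imsetP; exists (bar x) => //.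
  apply/setP=> y; rewrite mem_barset !inE !ext_bar.
  by rewrite -[C x in LHS]flipK (inj_eq (inv_inj flipK)).
- apply/forall_inP=> R /imsetP[x _ ->]; rewrite sgn_cls.
  have -> : (cls x == barset (cls x)) = (C (bar x) == C x).
    apply/eqP/eqP=> [e|e].
      have : x \in cls x by rewrite inE.
      by rewrite e mem_barset inE => /eqP.
    apply/setP=> y; rewrite mem_barset !inE ext_bar -[in RHS]e ext_bar.
    by rewrite (inj_eq (inv_inj flipK)).
  rewrite ext_bar; case: (C x) => [[j b]|t] /=; last by rewrite !eqxx.
  by apply/eqP/negbTE/eqP => -[]; case: b.
Qed.

Lemma decode : exists p : lpart n Sigma, pcode p =1 c.
Proof.
exists (LPart decode_proof) => i; set p := LPart _.
suff h x : pcode_dbl p x = C x by rewrite /pcode h.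
have bx : pblock (blocks p) x = cls x.
  by apply: blockE; rewrite ?imset_f ?inE.
have sx : sign p (cls x) = if C x is inr t then Some t else None.
  exact: sgn_cls.
case: pcodeP; rewrite bx sx.
  by move=> t; case: (C x) => // t' [->].
move=> y e; rewrite inE => /eqP ey ymin.
case eC: (C x) e ey ymin => [z|] // _ ey ymin.
(* The element [z] lies in its own fibre and its index is at most that of [y], so minimality of [y]
   makes the indices equal. The choice [y = bar z] is excluded because its value is [bar z]. *)
have [ez _] := ext_canonical eC.
have [_ zy] := ext_canonical ey.
have yz : (y.1 <= z.1)%N by apply: ymin; rewrite inE ez eC.
have /dbl_eq[->//|eyz] : y.1 = z.1 by apply/ord_inj/anti_leq; rewrite yz zy.
move: ey; rewrite eyz ext_bar ez /= => -[].
by case: (z) => ? [].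
Qed.

End Decode.

(** A signed block contains each index together with its bar, so the size [2] forbidden in types B
    and D means a single index. *)
Lemma sblock_card p t : #|sblock p t| = (2 * #|[set i | pcode p i == inr t]|)%N.
Proof.
have -> : sblock p t = setX [set i | pcode p i == inr t] [set: bool].
  apply/setP=> -[i b]; rewrite !inE andbT.
  have -> : (pcode p i == inr t) = (pcode_dbl p (i, b) == inr t).
    rewrite -pcode_ext /=; case: b => //=.
    by rewrite -(inj_eq (inv_inj flipK)).
  rewrite pcode_inr; apply/bigcupP/idP=> [[R /andP[Rp /eqP sR] xR]|/eqP e].
    by rewrite (blockE Rp) ?sR.
  by exists (pblock (blocks p) (i, b)); rewrite ?block_in ?e ?mem_block /=.
by rewrite cardsX cardsT card_bool mulnC.
Qed.

Lemma signs_pcode p t : (t \in signs p) = [exists i, pcode p i == inr t].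
Proof.
apply/signsP/existsP=> [[R Rp sR]|[i]].
  have [[i b] xR] := set0Pn _ (block_neq0 Rp); exists i.
  have : pcode_dbl p (i, b) == inr t by rewrite pcode_inr (blockE Rp) ?sR.
  by rewrite -pcode_ext /=; case: b {xR} => //=; case: (pcode p i).
by rewrite pcode_inr => /eqP e; exists (pblock (blocks p) (i, false)); rewrite ?block_in.
Qed.

(** In type A no block mixes barred and unbarred elements, so an unbarred index has an unbarred
    representative. Conversely, [rho] is taken to be the kernel of [pcode p]. *)
Lemma in_typeA_pcode p :
  reflect (forall i, exists r, pcode p i = inl (r, false)) (in_typeA p).
Proof.
apply: (iffP andP) => [[/forall_inP h1 /existsP[rho /andP[_ /eqP eb]]] i|h].
  rewrite /pcode; case: pcodeP => [t e|[r b] e rin _].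
    by have := h1 _ (block_in p (i, false)); rewrite e.
  exists r; suff -> : b = false by [].
  have : pblock (blocks p) (i, false) \in
      [set unbarred R | R in rho] :|: [set barset (unbarred R) | R in rho].
    by rewrite -eb block_in.
  rewrite inE => /orP[] /imsetP[R _ eR].
    by move: rin; rewrite eR => /imsetP[j _ [_ ->]].
  have := mem_block p (i, false); rewrite eR mem_barset => /imsetP[j _] //.
have hx x : exists r, pcode_dbl p x = inl (r, x.2).
  case: x => i b; have [r er] := h i; exists r.
  by rewrite -pcode_ext /= er; case: b.
split.
  apply/forall_inP=> R Rp; have [x xR] := set0Pn _ (block_neq0 Rp).
  have [r] := hx x; case: pcodeP => // y e _ _ _.
  by rewrite -(blockE Rp xR) e.
apply/existsP; exists (preim_partition (pcode p) setT).
rewrite preim_partitionP /=; apply/eqP/setP=> R.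
have hb i : pblock (blocks p) (i, false) =
    unbarred [set j in [set: 'I_n] | pcode p i == pcode p j].
  apply/setP=> -[j b]; rewrite -pcode_eq.
  apply/idP/imsetP=> [/eqP e|[j' + [-> ->]]]; last by rewrite !inE.
  have eb : b = false.
    have [r er] := hx (i, false); have [r' er'] := hx (j, b).
    by move: e; rewrite er er' => -[].
  by rewrite eb in e *; exists j; rewrite // !inE /pcode e eqxx.
rewrite inE; apply/idP/orP=> [Rp|[]/imsetP[T /imsetP[i _ ->] ->]].
- have [[i b] xR] := set0Pn _ (block_neq0 Rp); rewrite -(blockE Rp xR).
  case: b {xR}; [right|left]; apply/imsetP;
    exists [set j in [set: 'I_n] | pcode p i == pcode p j] => //.
  - exact: imset_f.
  - by rewrite -hb barset_block.
  - exact: imset_f.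
- by rewrite -hb block_in.
- by rewrite -hb barset_block block_in.
Qed.

End Codes.

(** * Covers as substitutions of roots *)

Section SignPosition.
Variables (Sigma : finType) (sbar : Sigma).
Implicit Types (S A : {set Sigma}) (t u : Sigma).

(** The sign [sbar] comes first so that it is the one introduced when no sign is in use; it is
    exempt from the size condition of type B. *)
Definition sign_rank t : nat := if t == sbar then 0 else (enum_rank t).+1.

Lemma sign_rank_inj : injective sign_rank.
Proof.
move=> t u; rewrite /sign_rank; have [->|_] := eqVneq t sbar.
  by have [->|] := eqVneq u sbar.
by case: eqVneq => // _ [] /val_inj/enum_rank_inj.
Qed.

Definition count_upto A t := #|[set u in A | (sign_rank u <= sign_rank t)%N]|.

(* The position of t when Sigma is listed with the elements of S first, both
   parts in increasing order. *)
Definition sign_pos S t : nat :=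
  if t \in S then count_upto S t else (#|S| + count_upto (~: S) t)%N.

Lemma count_upto_le A t : (count_upto A t <= #|A|)%N.
Proof. by apply/subset_leq_card/subsetP=> u; rewrite inE => /andP[]. Qed.

Lemma count_upto_gt0 A t : t \in A -> (0 < count_upto A t)%N.
Proof. by move=> tA; apply/card_gt0P; exists t; rewrite inE tA leqnn. Qed.

Lemma count_upto_ltn A t u : u \in A -> (sign_rank t < sign_rank u)%N ->
  (count_upto A t < count_upto A u)%N.
Proof.
move=> uA tu; apply: proper_card; apply/properP; split.
  by apply/subsetP=> w; rewrite !inE => /andP[->] /leq_trans-> //; apply: ltnW.
by exists u; rewrite !inE uA ?leqnn //= -ltnNge.
Qed.

Lemma count_upto_lt_rank A t u : t \in A -> u \in A ->
  (count_upto A t < count_upto A u)%N = (sign_rank t < sign_rank u)%N.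
Proof.
move=> tA uA; apply/idP/idP; last exact: count_upto_ltn.
case: (ltngtP (sign_rank t) (sign_rank u)) => // [ut|/sign_rank_inj->].
  by rewrite ltnNge ltnW // count_upto_ltn.
by rewrite ltnn.
Qed.

Lemma count_uptoD1 A t u : t \in A -> (sign_rank t <= sign_rank u)%N ->
  count_upto A u = (count_upto (A :\ t) u).+1.
Proof.
move=> tA tu; rewrite /count_upto (cardsD1 t) inE tA tu add1n; congr _.+1.
by apply: eq_card => w; rewrite !inE andbA.
Qed.

Lemma count_uptoD1_le A t u : (count_upto (A :\ t) u <= count_upto A u)%N.
Proof.
by apply/subset_leq_card/subsetP=> w; rewrite !inE -andbA => /and3P[_ -> ->].
Qed.

Lemma sign_pos_gt0 S t : (0 < sign_pos S t)%N.
Proof.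
rewrite /sign_pos; case: ifPn => tS; first exact: count_upto_gt0.
by rewrite addn_gt0 orbC count_upto_gt0 // inE.
Qed.

Lemma sign_pos_le S t : (sign_pos S t <= #|Sigma|)%N.
Proof.
rewrite /sign_pos -(cardsC S); have h1 := count_upto_le S t.
have := count_upto_le (~: S) t; case: ifP => _; lia.
Qed.

Lemma sign_pos_in S t : (t \in S) = (sign_pos S t <= #|S|)%N.
Proof.
rewrite /sign_pos; case: ifPn => tS; first by rewrite count_upto_le.
have : (0 < count_upto (~: S) t)%N by rewrite count_upto_gt0 // inE.
lia.
Qed.

Lemma sign_pos_inj S : injective (sign_pos S).
Proof.
move=> t u e; have := sign_pos_in S t; rewrite e -sign_pos_in.
move: e; rewrite /sign_pos; case: ifPn => uS; case: ifPn => tS // e _.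
  apply/sign_rank_inj; have := count_upto_lt_rank tS uS.
  have := count_upto_lt_rank uS tS; rewrite e ltnn; lia.
move: e => /addnI e; have uC : u \in ~: S by rewrite inE.
have tC : t \in ~: S by rewrite inE.
apply/sign_rank_inj; have := count_upto_lt_rank tC uC.
have := count_upto_lt_rank uC tC; rewrite e ltnn; lia.
Qed.

(** This yields the non-increasing label after a sign step [u] that was taken out of turn or must be
    repeated. Bringing [u] into the used part delays [t] by at most one place, and a [t] strictly
    before [u] does not pass the old place of [u]. *)
Lemma sign_posU1_le S t u : (sign_pos S t <= sign_pos S u)%N ->
  (sign_pos (u |: S) t <= sign_pos S u)%N.
Proof.
have [uS|uS tu] := boolP (u \in S).
  by have /setUidPr -> : [set u] \subset S by rewrite sub1set.
have : (#|S| < sign_pos S u)%N by rewrite ltnNge -sign_pos_in.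
have cU : #|u |: S| = #|S|.+1 by rewrite cardsU1 uS.
have [tU|tU] := boolP (t \in u |: S).
  by apply: leq_trans; rewrite -cU -sign_pos_in.
move=> _; have : t \notin S by apply: contra tU; rewrite inE orbC => ->.
move=> tS; move: tu; rewrite /sign_pos (negPf tS) (negPf uS) (negPf tU) cU.
rewrite leq_add2l addSn -addnS leq_add2l setCU setIC -setDE.
have uC : u \in ~: S by rewrite inE.
have tC : t \in ~: S by rewrite inE.
have ntu : t != u by apply: contraNneq tU => ->; rewrite setU11.
move=> le1; apply: leq_ltn_trans (count_uptoD1_le _ _ _) _.
rewrite ltn_neqAle le1 andbT; apply: contraNneq ntu => e.
by apply/eqP/(@sign_pos_inj S); rewrite /sign_pos (negPf tS) (negPf uS) e.
Qed.

Lemma sign_posU1 S t u : (sign_pos S t < sign_pos S u)%N ->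
  sign_pos (t |: S) u = sign_pos S u.
Proof.
have [tS|tS tu] := boolP (t \in S).
  by have /setUidPr -> : [set t] \subset S by rewrite sub1set.
have : (#|S| < sign_pos S t)%N by rewrite ltnNge -sign_pos_in.
move=> /ltn_trans/(_ tu); rewrite ltnNge -sign_pos_in => uS.
have cU : #|t |: S| = #|S|.+1 by rewrite cardsU1 tS.
have ntu : u != t by apply: contraTneq tu => ->; rewrite ltnn.
move: tu; rewrite /sign_pos !inE (negPf tS) (negPf uS) (negPf ntu) cU /=.
have uC : u \in ~: S by rewrite inE.
have tC : t \in ~: S by rewrite inE.
rewrite ltn_add2l count_upto_lt_rank // => /ltnW rtu.
by rewrite (count_uptoD1 tC rtu) addnS addSn setCU setIC -setDE.
Qed.

(** The last sign step below the maximum uses this sign: it either enlarges a signed block or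
    creates one with the sign [sbar]. *)
Lemma sign_pos_first S :
  exists2 t, sign_pos S t = 1 & t \in S \/ S = set0 /\ t = sbar.
Proof.
have [->|[t0 t0S]] := set_0Vmem S.
  exists sbar; last by right.
  rewrite /sign_pos inE cards0 add0n /count_upto -(cards1 sbar).
  apply: eq_card => u; rewrite !inE /sign_rank eqxx /=.
  by case: eqVneq.
case: (@arg_minnP _ t0 (fun t => t \in S) sign_rank t0S) => t tS tmin.
exists t; last by left.
rewrite /sign_pos tS /count_upto -(cards1 t).
apply: eq_card => u; rewrite !inE; apply/andP/eqP=> [[uS ut]|-> //].
by apply/sign_rank_inj/anti_leq; rewrite ut tmin.
Qed.

End SignPosition.

(** * Elementary steps, covers and their labels *)

Section Steps.
Variables (n : nat) (Sigma : finType) (sbar : Sigma).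

Let P := lposet n Sigma.
Implicit Types (p q z g : lpart n Sigma) (i r s : 'I_n) (v : code n Sigma).
Implicit Types (t : Sigma) (y : P).

Definition is_root p i : bool := pcode p i == inl (i, false).

Definition target p s v : bool :=
  if v is inl x then (x.1 < s)%N && is_root p x.1 else true.

Definition subst s v (w : code n Sigma) : code n Sigma :=
  if w is inl x then if x.1 == s then twist x.2 v else inl x else w.

Definition step p s v z : Prop :=
  [/\ is_root p s, target p s v & forall i, pcode z i = subst s v (pcode p i)].

(* Merging the block of s into the block of v (or giving it the sign v) is
   possible below y. *)
Definition compat y s v : bool :=
  if y is Some q then ext (pcode q) v == pcode q s else true.

Lemma pcode_root p i x : pcode p i = inl x -> (x.1 <= i)%N /\ is_root p x.1.
Proof. by move=> /pcode_canonical[? ?]; split=> //; apply/eqP. Qed.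

Lemma ext_id p i : ext (pcode p) (pcode p i) = pcode p i.
Proof. by have /le_pcode := lexx p; apply. Qed.

(** The root of [i] in [p] has index at most [i], while its own root in [q] is [i] up to a bar; so
    the two indices agree. *)
Lemma root_le p q i : p <= q -> is_root q i -> is_root p i.
Proof.
move=> /le_pcode/(_ i) + /eqP e; rewrite e.
case ep: (pcode p i) => [[r b]|t] //= h.
have [ri _] := pcode_root ep; rewrite /= in ri.
have [b' eqr] : exists b', pcode q r = inl (i, b').
  case: b h {ep} => /= [h|->]; last by exists false.
  by exists true; rewrite -[pcode q r]flipK h.
have [ir _] := pcode_root eqr; have ei : i = r by apply/ord_inj/anti_leq; rewrite ri ir.
by rewrite ei; have [_] := pcode_root ep.
Qed.

(** Codes in [p] are signs or roots up to a bar, and [q] then fixes all of them. With [root_le], the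
    set of roots strictly shrinks along [<]. *)
Lemma le_root_eq p q : p <= q -> (forall i, is_root p i -> is_root q i) -> p = q.
Proof.
move=> /le_pcode pq h; apply: pcode_inj => i; rewrite -pq.
case ep: (pcode p i) => [[r b]|t] //=.
by have [_ /h/eqP ->] := pcode_root ep; case: b {ep}.
Qed.

(** The target is a sign or a smaller root, so redirecting to it everything that points to [s] keeps
    the code canonical. *)
Lemma step_ex p s v : is_root p s -> target p s v -> exists z, step p s v z.
Proof.
move=> rs tv; have [|z ez] := @decode _ _ (fun i => subst s v (pcode p i)).
  move=> i x; case e: (pcode p i) => [y|t] //=.
  have [yi ry] := pcode_root e; case: eqP => [ys|ys] ex.
    have [w ev] : exists2 w, v = inl w & x.1 = w.1.
      case: v ex {tv} => [w|t]; case: (y.2) => //= -[ex]; exists w => //;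
        by rewrite -ex.
    move=> exw; move: tv; rewrite ev /= -exw => /andP[lt /eqP ->] /=.
    rewrite ifN; last by rewrite neq_ltn lt.
    by split=> //; rewrite (leq_trans _ yi) // ys ltnW.
  case: ex => <-; split=> //; move/eqP: ry => -> /=.
  by case: eqP ys.
by exists z; split.
Qed.

Lemma step_uniq p s v z z' : step p s v z -> step p s v z' -> z = z'.
Proof. by move=> [_ _ e] [_ _ e']; apply: pcode_inj => i; rewrite e e'. Qed.

Lemma step_pcode p s v z : step p s v z -> pcode z s = v.
Proof. by case=> /eqP rs _ ->; rewrite rs /= eqxx. Qed.

Lemma step_root p s v z i : step p s v z -> is_root z i = is_root p i && (i != s).
Proof.
move=> st; have [rs tv ez] := st; rewrite /is_root ez.
case ep: (pcode p i) => [[r b]|t] //=; case: (eqVneq r s) => [ers|rs'].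
  rewrite {}ers in ep *.
  have -> : ((inl (s, b) : code n Sigma) == inl (i, false)) && (i != s) = false.
    by apply/andP=> -[/eqP[->]]; rewrite eqxx.
  apply/eqP=> h; have [w ev ew] : exists2 w, v = inl w & w.1 = i.
    case: v h {st tv ez} => [w|t]; case: b {ep} => //= -[h]; exists w => //;
      by rewrite h.
  move: tv; rewrite ev /= ew => /andP[lt /eqP].
  rewrite ep => -[es _]; by rewrite es ltnn in lt.
by case: eqP => //= -[<- _]; rewrite rs'.
Qed.

Lemma step_le p s v z q : step p s v z -> p <= q ->
  (z <= q) = (ext (pcode q) v == pcode q s).
Proof.
move=> st /le_pcode pq; apply/le_pcode/eqP=> [/(_ s)|h i].
  by rewrite (step_pcode st).
have [_ _ ->] := st; rewrite -pq; case: (pcode p i) => [x|t] //=.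
by case: eqP => [->|//]; rewrite ext_twist h.
Qed.

Lemma step_lt p s v z : step p s v z -> p < z.
Proof.
move=> st; rewrite lt_neqAle; apply/andP; split.
  apply/eqP=> e; have := step_root s st; rewrite -e eqxx andbF.
  by case: st => ->.
apply/le_pcode => i; have [rs tv ez] := st.
rewrite (ez i); case: (pcode p i) (@pcode_root p i) => [x|t] //= /(_ _ erefl)[_ rx].
rewrite ez; move/eqP: rx => -> /=; case: eqP => //= _.
by case: x => ? [].
Qed.

Lemma ltSome p q : ((Some p : P) < Some q) = (p < q).
Proof. by rewrite !lt_neqAle. Qed.

(** Only the root [s] is lost, so an element in between has the roots of [p] or those of [z], and
    [le_root_eq] identifies it. *)
Lemma step_covers p s v z : step p s v z -> covers (Some p : P) (Some z).
Proof.
move=> st; apply/andP; split; first by rewrite ltSome (step_lt st).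
apply/existsPn => -[q|]; last by apply/negP=> /andP[_ /ltW].
rewrite !ltSome; apply/negP=> /andP[pq qz].
have [rqs|rqs] := boolP (is_root q s).
  suff e : p = q by rewrite e ltxx in pq.
  apply: le_root_eq (ltW pq) _ => i rp; have [->//|ns] := eqVneq i s.
  by apply: (root_le (ltW qz)); rewrite (step_root _ st) rp.
suff e : q = z by rewrite e ltxx in qz.
apply: le_root_eq (ltW qz) _ => i rq.
rewrite (step_root _ st) (root_le (ltW pq)) //=.
by apply: contraNneq rqs => <-.
Qed.

Lemma lt_step p q : p < q -> exists s, is_root p s /\ target p s (pcode q s).
Proof.
move=> pq; have /existsP[s /andP[rp rq]] : [exists s, is_root p s && ~~ is_root q s].
  apply: contraT => /existsPn h; suff e : p = q by rewrite e ltxx in pq.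
  apply: le_root_eq (ltW pq) _ => i rp.
  by have := h i; rewrite rp negbK.
exists s; split=> //; case e: (pcode q s) => [x|t] //=.
have [xs rx] := pcode_root e; rewrite (root_le (ltW pq)) // andbT.
rewrite ltn_neqAle xs andbT; apply: contraNneq rq => /ord_inj ex.
by rewrite -ex.
Qed.

(** The step from [p] that sends a lost root to its code in [z] stays below [z], and a cover leaves
    no room for it to differ from [z]. *)
Lemma covers_step p z : covers (Some p : P) (Some z) ->
  exists s v, step p s v z.
Proof.
move=> cv; have := covers_lt cv; rewrite ltSome => pz.
have [s [rs tv]] := lt_step pz; have [z0 st] := step_ex rs tv.
exists s, (pcode z s); suff e : z0 = z by move: st; rewrite e.
have := step_le st (ltW pz); rewrite ext_id eqxx le_eqVlt.
case/predU1P => // z0z; case/andP: cv => _ /existsPn/(_ (Some z0)).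
by rewrite !ltSome z0z (step_lt st).
Qed.

Lemma covers_below p z y : covers (Some p : P) (Some z) -> (Some z : P) <= y ->
  exists s v, step p s v z /\ compat y s v.
Proof.
move=> cv zy; have [s [v st]] := covers_step cv; exists s, v; split=> //.
case: y zy => //= q zq; rewrite -(step_le st) //.
exact: le_trans (ltW (step_lt st)) zq.
Qed.

(** A remaining root could still receive the sign [sbar]. *)
Lemma covers_None p i : covers (Some p : P) None -> ~~ is_root p i.
Proof.
move=> /andP[_ /existsPn h]; apply/negP=> ri.
have [//|z st] := @step_ex p i (inr sbar) ri.
by have := h (Some z); rewrite ltSome (step_lt st).
Qed.

Lemma None_covers p : (forall i, ~~ is_root p i) -> covers (Some p : P) None.
Proof.
move=> h; apply/andP; split; first by [].
apply/existsPn => -[q|]; last by rewrite ltxx andbF.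
rewrite ltSome andbT; apply/negP=> pq.
by have [s [rs _]] := lt_step pq; have := h s; rewrite rs.
Qed.

(** The source [s] is enough to label coherent merges, since the least available one has a single
    target by [coherent_min_uniq]. Sign labels occupy [n + 1] to [n + #|Sigma|]. *)
Definition move_label p s v : nat :=
  match v with
  | inl (r, false) => s
  | inl (r, true) => n + #|Sigma| + 3 + r
  | inr t => n + sign_pos sbar (signs p) t
  end.

(** On a cover between two partitions exactly one root is lost, so [pick] finds it and the default
    [0] is never returned. *)
Definition label (x y : P) : nat :=
  match x, y with
  | Some p, Some z =>
      if [pick s | is_root p s && ~~ is_root z s] is Some s
      then move_label p s (pcode z s) else 0
  | _, _ => n + 2
  end.

Arguments label : simpl never.

Lemma step_label p s v z : step p s v z ->
  label (Some p) (Some z) = move_label p s v.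
Proof.
move=> st; rewrite /label; case: pickP => [i|/(_ s)].
  rewrite (step_root _ st) => /andP[->]; rewrite /= negbK => /eqP ->.
  by rewrite (step_pcode st).
by rewrite (step_root _ st) eqxx andbF; case: st => ->.
Qed.

Lemma step_signs p s v z : step p s v z ->
  signs z = (if v is inr t then t |: signs p else signs p).
Proof.
move=> st; have [rs tv ez] := st; apply/setP=> t.
have -> : (t \in signs z) = (v == inr t) || (t \in signs p).
  rewrite !signs_pcode; apply/existsP/orP=> [[i]|[/eqP ev|/existsP[i /eqP e]]].
  - rewrite ez; case e: (pcode p i) => [x|t'] /=.
      by case: ifP => // _; case: (x.2); case: (v) => //= ? /eqP[->]; left.
    by move=> et; right; apply/existsP; exists i; rewrite e.
  - by exists s; rewrite (step_pcode st) ev.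
  - by exists i; rewrite ez e.
by case: v {st tv ez} => [x|t'] //; rewrite !inE eq_sym.
Qed.

Lemma step_below p y s v : (Some p : P) <= y -> is_root p s -> target p s v ->
  compat y s v ->
  exists z, [/\ step p s v z, covers (Some p : P) (Some z), (Some z : P) <= y
    & label (Some p) (Some z) = move_label p s v].
Proof.
move=> py rs tv cv; have [z st] := step_ex rs tv; exists z; split=> //.
- exact: step_covers st.
- by case: y py cv => // q pq /=; rewrite -(step_le st).
- exact: step_label.
Qed.

Lemma ex_cover p y s v m : (Some p : P) <= y -> is_root p s -> target p s v ->
  compat y s v -> (move_label p s v <= m)%N ->
  exists w, [/\ covers (Some p : P) w, w <= y & (label (Some p) w <= m)%N].
Proof.
move=> py rs tv cv lm; have [z [_ cz zy lz]] := step_below py rs tv cv.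
by exists (Some z); split=> //; rewrite lz.
Qed.

Lemma label_None p : label (Some p) None = (n + 2)%N.
Proof. by []. Qed.

End Steps.
Arguments label : simpl never.

(** * The greedy cover *)

Section GreedySteps.
Variables (n : nat) (Sigma : finType) (sbar : Sigma).

Let P := lposet n Sigma.
Let lab := @label n Sigma sbar.
Implicit Types (p q z g : lpart n Sigma) (i r s : 'I_n) (v : code n Sigma).
Implicit Types (t : Sigma) (y : P).

Lemma ltn_ord_add s m : (s < n + m)%N.
Proof. by rewrite ltn_addr. Qed.

Lemma ltn_ord_noncoherent s m : (s < n + #|Sigma| + 3 + m)%N.
Proof. by rewrite -!addnA ltn_addr. Qed.

Lemma ltn_sign_noncoherent S t m :
  (n + sign_pos sbar S t < n + #|Sigma| + 3 + m)%N.
Proof. by have := sign_pos_le sbar S t; lia. Qed.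

Definition coherent p y r s : bool :=
  [&& is_root p r, is_root p s, (r < s)%N & compat y s (inl (r, false))].

Lemma coherent_step p y r s s' v z : step p s' v z ->
  coherent z y r s = [&& coherent p y r s, r != s' & s != s'].
Proof.
move=> st; rewrite /coherent !(step_root _ st).
by case: (is_root p r); case: (is_root p s); case: (r != s'); case: (s != s');
  rewrite ?andbT ?andbF.
Qed.

Lemma compat_coherent_inr y r s t : compat y s (inl (r, false)) ->
  compat y r (inr t) = compat y s (inr t).
Proof. by case: y => //= q /eqP ->. Qed.

(** A block containing [r] and its bar is signed. Below the maximum every move is compatible and
    [sbar] will do. *)
Lemma compat_self y r : compat y r (inl (r, true)) ->
  exists t, compat y r (inr t).
Proof.
case: y => [q|] /=; last by exists sbar.
case: (pcode q r) => [[j b]|t] /=; last by exists t.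
by move/eqP=> -[]; case: b.
Qed.

Lemma compat_sym y r s b : compat y s (inl (r, b)) -> compat y r (inl (s, b)).
Proof.
case: y => //= q; case: b => /= /eqP <- //.
by rewrite flipK.
Qed.

Lemma compat_trans y r s u b b' : compat y s (inl (r, b)) ->
  compat y u (inl (s, b')) -> compat y u (inl (r, b (+) b')).
Proof.
case: y => //= q /eqP <- /eqP <-.
by case: b b' => -[] //=; rewrite flipK.
Qed.

(** If both [r < r'] could absorb [s], then [r] could absorb [r'], and [r' < s] contradicts
    minimality. *)
Lemma coherent_min_uniq p y r r' s :
  (forall r0 s0, coherent p y r0 s0 -> (s <= s0)%N) ->
  coherent p y r s -> coherent p y r' s -> r = r'.
Proof.
move=> smin; wlog lt : r r' / (r < r')%N => [hw|] h h'.
  case: (ltngtP r r') => [lt|lt|/ord_inj //]; [exact: hw|].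
  exact/esym/hw.
case/and4P: h h' => rr _ _ c /and4P[rr' _ lts c'].
have /smin : coherent p y r r'.
  by rewrite /coherent rr rr' lt; have := compat_trans c (compat_sym c').
by rewrite leqNgt lts.
Qed.

Lemma greedy_coherent p y r s : (Some p : P) <= y -> coherent p y r s ->
  (forall r' s', coherent p y r' s' -> (s <= s')%N) ->
  exists2 g, greedy lab (Some p : P) y (Some g) & step p s (inl (r, false)) g.
Proof.
move=> py coh smin; have [rr rs lrs crs] := and4P coh.
have [|g [stg cg gy lg]] := step_below sbar py rs _ crs; first by rewrite /= lrs.
have sn := ltn_ord s; rewrite /= in lg.
exists g => //; split=> // [[z|]|[w|]] cz; last 2 first.
- move=> wy; have [s' [v' [st' cp']]] := covers_below cz wy.
  have [rs' tv' _] := st'; rewrite /lab lg (step_label sbar st').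
  case: v' st' cp' tv' => [[r' []]|t] st' cp' /= tv'.
  1: exact: ltn_ord_noncoherent.
  2: exact: ltn_ord_add.
  (* Coherent merges out of [g] were already available at [p], and [s] is no longer a root. *)
  have : coherent g y r' s'.
    by case/andP: tv' => lt' rr'; rewrite /coherent rs' rr' lt'.
  rewrite (coherent_step _ _ _ stg) => /and3P[/smin + _ ns].
  rewrite leq_eqVlt => /predU1P[/ord_inj es|//].
  by rewrite es eqxx in ns.
- by move=> _; rewrite /lab lg label_None ltn_ord_add.
2: by have := covers_None sbar r cz; rewrite rr.
move=> zy nz; have [s' [v' [st' cp']]] := covers_below cz zy.
have [rs' tv' _] := st'; rewrite /lab lg (step_label sbar st').
have rz i : is_root z i = is_root p i && (i != s') by apply: step_root st'.
(* Unless the move to [z] consumed [r] or [s], merging [s] into [r] is still possible and supplies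
   the low label. *)
have coh_w m : r != s' -> s != s' -> (s <= m)%N ->
    exists w, [/\ covers (Some z : P) w, w <= y & (label sbar (Some z) w <= m)%N].
  move=> nr ns sm; apply: (ex_cover zy (s := s) (v := inl (r, false))) => //.
    by rewrite rz rs.
  by rewrite /= lrs rz rr.
case: v' st' cp' tv' => [[r' []]|t] st' cp' /= tv'.
- case/andP: tv' => lt' rr'; split; first exact: ltn_ord_noncoherent.
  have [es|ns] := eqVneq s' s; last first.
    have [er|nr] := eqVneq s' r; last first.
      by apply: coh_w; rewrite 1?eq_sym // ltnW // ltn_ord_noncoherent.
    (* Here [r] went noncoherently to [r'], so [s], which is coherent with [r], can follow it with
       the same label. *)
    rewrite {}er in lt' cp' rz coh_w st' *.
    apply: (ex_cover zy (s := s) (v := inl (r', true))) => //.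
    + by rewrite rz rs neq_ltn lrs orbT.
    + by rewrite /= rz rr' !neq_ltn lt' (ltn_trans lt').
    + exact: compat_trans cp' crs.
  rewrite {}es in lt' cp' rz coh_w st' *.
  (* Now [r] and [bar r'] can be merged below [y]. The label of that merge is given by the smaller
     of [r] and [r'], hence is not larger than the previous one; if they coincide, [r] can be signed
     instead. *)
  have cc := compat_trans cp' (compat_sym crs).
  have rzr : is_root z r by rewrite rz rr neq_ltn lrs.
  have rzr' : is_root z r' by rewrite rz rr' neq_ltn lt'.
  case: (ltngtP r r') => [lt|lt|/ord_inj er].
  + apply: (ex_cover zy (s := r') (v := inl (r, true))) => //=.
    * by rewrite lt.
    * exact: compat_sym cc.
    * by rewrite leq_add2l ltnW.
  + apply: (ex_cover zy (s := r) (v := inl (r', true))) => //=.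
    by rewrite lt.
  + rewrite -er in cc; have [t ct] := compat_self cc.
    apply: (ex_cover zy (s := r) (v := inr t)) => //=.
    exact/ltnW/ltn_sign_noncoherent.
- case/andP: tv' => lt' rr'.
  have coh' : coherent p y r' s' by rewrite /coherent rs' rr' lt'.
  have := smin _ _ coh'; rewrite leq_eqVlt => /predU1P[/ord_inj es|lt].
    rewrite -{}es in coh' st'; have er := coherent_min_uniq smin coh coh'.
    by case: nz; rewrite -er in st'; rewrite (step_uniq st' stg).
  split=> //; apply: coh_w; rewrite ?(ltnW lt) //.
    by rewrite neq_ltn (ltn_trans lrs).
  by rewrite neq_ltn lt.
- split; first exact: ltn_ord_add.
  (* If [r] or [s] has just received [t], the other one can take [t] as well, and the position of
     [t] has not grown. *)
  have sgn_w u : is_root z u -> compat y u (inr t) -> exists w,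
    [/\ covers (Some z : P) w, w <= y
      & (label sbar (Some z) w <= n + sign_pos sbar (signs p) t)%N].
    move=> ru cu; apply: (ex_cover zy (s := u) (v := inr t)) => //=.
    by rewrite leq_add2l (step_signs st') sign_posU1_le.
  have [es|ns] := eqVneq s' s.
    apply: (sgn_w r); first by rewrite rz rr es neq_ltn lrs.
    by rewrite (compat_coherent_inr _ crs) -es.
  have [er|nr] := eqVneq s' r.
    apply: (sgn_w s); first by rewrite rz rs er neq_ltn lrs orbT.
    by rewrite -(compat_coherent_inr _ crs) -er.
  by apply: coh_w; rewrite 1?eq_sym // ltnW // ltn_ord_add.
Qed.

Lemma greedy_sign p q s t : p <= q ->
  (forall r s', ~~ coherent p (Some q) r s') ->
  is_root p s -> pcode q s = inr t ->
  (forall s' t', is_root p s' -> pcode q s' = inr t' ->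
     (sign_pos sbar (signs p) t <= sign_pos sbar (signs p) t')%N) ->
  exists2 g, greedy lab (Some p : P) (Some q) (Some g) & step p s (inr t) g.
Proof.
move=> pq ncoh rs eqs tmin.
(* Two roots with the same sign in [q] could be merged coherently. *)
have uniq s' : is_root p s' -> pcode q s' = inr t -> s' = s.
  move=> rs' es'; case: (ltngtP s s') => [lt|lt|/ord_inj //].
    by have := ncoh s s'; rewrite /coherent rs rs' lt /= eqs es' eqxx.
  by have := ncoh s' s; rewrite /coherent rs rs' lt /= eqs es' eqxx.
have cs : compat (Some q) s (inr t) by rewrite /= eqs.
have [//|g [stg cg gy lg]] := step_below sbar (pq : (Some p : P) <= Some q) rs _ cs.
exists g => //; split=> // [[z|]|[w|]] // cz zq.
  move=> nz; have [s' [v' [st' cp']]] := covers_below cz zq.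
  have [rs' tv' _] := st'; rewrite /lab lg (step_label sbar st').
  have rz i : is_root z i = is_root p i && (i != s') by apply: step_root st'.
  case: v' st' cp' tv' => [[r' []]|t'] st' cp' /= tv'.
  - case/andP: tv' => lt' rr'; split; first exact: ltn_sign_noncoherent.
    (* The root [s] survives: merging it into [r'] would give [r'] the sign [t] in [q], against
       [uniq]. *)
    have rzs : is_root z s.
      rewrite rz rs /=; apply: contraTneq cp' => es; rewrite /= -es eqs.
      apply/eqP=> e; have : pcode q r' = inr t by case: (pcode q r') e => //= ? [->].
      by move/(uniq _ rr')=> er; rewrite er -es ltnn in lt'.
    apply: (ex_cover zq (s := s) (v := inr t)) => //=.
    exact/ltnW/ltn_sign_noncoherent.
  - case/andP: tv' => lt' rr'; have := ncoh r' s'.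
    by rewrite /coherent rs' rr' lt' cp'.
  - move/eqP: cp' => /= /esym cp'.
    have ntt : t != t'.
      apply: contra_notN nz => /eqP et; rewrite -et in cp' st'.
      by rewrite (uniq _ rs' cp') in st'; rewrite (step_uniq st' stg).
    have le1 := tmin _ _ rs' cp'.
    split.
      rewrite ltn_add2l ltn_neqAle le1 andbT; apply: contraNneq ntt.
      by move/sign_pos_inj->.
    apply: (ex_cover zq (s := s) (v := inr t)) => //=.
      rewrite rz rs; apply: contraNneq ntt => es.
      by move: cp'; rewrite -es eqs => -[->].
    by rewrite leq_add2l (step_signs st') sign_posU1_le.
have [s' [v' [st' cp']]] := covers_below cz zq.
have [rs' tv' _] := st'; rewrite /lab lg (step_label sbar st').
move: rs'; rewrite (step_root _ stg) => /andP[rs' ns'].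
case: v' st' cp' tv' => [[r' []]|t'] st' cp' /= tv'.
  exact: ltn_sign_noncoherent.
  case/andP: tv' => lt'; rewrite (step_root _ stg) => /andP[rr' _].
  by have := ncoh r' s'; rewrite /coherent rs' rr' lt' cp'.
move/eqP: cp' => /= /esym cp'.
rewrite (step_signs stg) ltn_add2l.
have lt1 : (sign_pos sbar (signs p) t < sign_pos sbar (signs p) t')%N.
  rewrite ltn_neqAle (tmin s') // andbT; apply: contraNneq ns'.
  by move/sign_pos_inj=> et; rewrite -et in cp'; rewrite (uniq _ rs' cp').
by rewrite sign_posU1.
Qed.

(** Two noncoherent relations compose to a coherent one, so each root is related to at most one
    other. The available moves are therefore disjoint pairs, and they are performed in the order of
    their smaller roots. *)
Lemma greedy_noncoherent p q r s : p <= q ->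
  (forall r' s', ~~ coherent p (Some q) r' s') ->
  (forall s' t, is_root p s' -> pcode q s' != inr t) ->
  is_root p r -> is_root p s -> (r < s)%N -> compat (Some q : P) s (inl (r, true)) ->
  (forall r' s', is_root p r' -> is_root p s' -> (r' < s')%N ->
     compat (Some q : P) s' (inl (r', true)) -> (r <= r')%N) ->
  exists2 g, greedy lab (Some p : P) (Some q) (Some g)
    & step p s (inl (r, true)) g.
Proof.
move=> pq ncoh nsgn rr rs lrs crs rmin.
have nc r' s' : is_root p r' -> is_root p s' ->
    compat (Some q : P) s' (inl (r', false)) -> r' = s'.
  move=> rr' rs' c; case: (ltngtP r' s') => [lt|lt|/ord_inj //].
    by have := ncoh r' s'; rewrite /coherent rr' rs' lt c.
  by have := ncoh s' r'; rewrite /coherent rr' rs' lt (compat_sym c).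
have [|g [stg cg gy lg]] :=
  step_below sbar (pq : (Some p : P) <= Some q) rs _ crs; first by rewrite /= lrs.
exists g => //; split=> // [[z|]|[w|]] // cz zq.
  move=> nz; have [s' [v' [st' cp']]] := covers_below cz zq.
  have [rs' tv' _] := st'; rewrite /lab lg (step_label sbar st').
  have rz i : is_root z i = is_root p i && (i != s') by apply: step_root st'.
  case: v' st' cp' tv' => [[r' []]|t'] st' cp' /= tv'; last first.
  - by move/eqP: cp' (nsgn s' t' rs') => /= <-; rewrite eqxx.
  - case/andP: tv' => lt' rr'; have := ncoh r' s'.
    by rewrite /coherent rs' rr' lt' cp'.
  case/andP: tv' => lt' rr'.
  have lerr := rmin _ _ rr' rs' lt' cp'.
  have [es|ns] := eqVneq s' s.
    rewrite {}es in rs' cp' lt' st' *.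
    have er : r = r' by apply: nc => //; have := compat_trans crs (compat_sym cp').
    by case: nz; rewrite -er in st'; rewrite (step_uniq st' stg).
  have ltrr : (r < r')%N.
    rewrite ltn_neqAle lerr andbT; apply: contraNneq ns => /ord_inj er.
    rewrite -er in cp'; apply/eqP; apply: nc => //.
    have := compat_trans (compat_sym cp') crs; exact.
  split; first by rewrite ltn_add2l.
  apply: (ex_cover zq (s := s) (v := inl (r, true))) => //=.
    by rewrite rz rs eq_sym.
    by rewrite lrs rz rr neq_ltn (ltn_trans ltrr).
  by rewrite leq_add2l.
have [s' [v' [st' cp']]] := covers_below cz zq.
have [rs' tv' _] := st'; rewrite /lab lg (step_label sbar st').
move: rs'; rewrite (step_root _ stg) => /andP[rs' ns'].
case: v' st' cp' tv' => [[r' []]|t'] st' cp' /= tv'; last first.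
- by move/eqP: cp' (nsgn s' t' rs') => /= <-; rewrite eqxx.
- case/andP: tv' => lt'; rewrite (step_root _ stg) => /andP[rr' _].
  by have := ncoh r' s'; rewrite /coherent rs' rr' lt' cp'.
case/andP: tv' => lt'; rewrite (step_root _ stg) => /andP[rr' _].
have := rmin _ _ rr' rs' lt' cp'; rewrite leq_eqVlt.
case/predU1P=> [/ord_inj er|]; last by rewrite ltn_add2l.
rewrite -er in cp'; case/negP: ns'; apply/eqP; apply/esym/nc => //.
have := compat_trans (compat_sym crs) cp'; exact.
Qed.

(** Exactly two moves remain, a sign and then the maximum. The latter has label [n + 2], so the word
    increases only if the sign has position [1]. *)
Lemma greedy_last_root p s t : is_root p s -> (forall i, is_root p i -> i = s) ->
  sign_pos sbar (signs p) t = 1 ->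
  exists2 g, greedy lab (Some p : P) None (Some g) & step p s (inr t) g.
Proof.
move=> rs suniq t1.
have [//|//|g [stg cg gy lg]] :=
  step_below (v := inr t) sbar (isT : (Some p : P) <= None) rs.
have none z v : step p s v z -> covers (Some z : P) None.
  move=> st; apply: None_covers => i; rewrite (step_root _ st).
  by apply/negP=> /andP[/suniq ->]; rewrite eqxx.
have norm z : covers (Some p : P) (Some z) -> exists t', step p s (inr t') z.
  move=> cz; have [s' [v' st']] := covers_step cz.
  have [/suniq es tv' _] := st'; rewrite {}es in st' tv'.
  case: v' st' tv' => [x|t'] st' /= tv'; last by exists t'.
  by case/andP: tv' => lt /suniq e; rewrite e ltnn in lt.
exists g => //; split=> // [[z|]|[w|]] // cz _.
- move=> nz; have [t' st'] := norm _ cz; rewrite /lab lg (step_label sbar st').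
  have lt1 : (1 < sign_pos sbar (signs p) t')%N.
    have := sign_pos_gt0 sbar (signs p) t'; rewrite leq_eqVlt => /predU1P[e|//].
    case: nz; have et : t = t' by apply: (@sign_pos_inj _ sbar (signs p)); rewrite t1 e.
    by rewrite -et in st'; rewrite (step_uniq st' stg).
  rewrite /= t1 ltn_add2l lt1; split=> //; exists None; split=> //.
    exact: none st'.
  by rewrite label_None leq_add2l.
- by have := covers_None sbar s cz; rewrite rs.
- have [s' [v' [rs' _ _]]] := covers_step cz; move: rs'; rewrite (step_root _ stg).
  by case/andP=> /suniq ->; rewrite eqxx.
- by rewrite /lab lg label_None /= t1 ltn_add2l.
Qed.

(* Types B, C and D are the cases N = ~: [set sbar], set0 and setT. *)
Definition no_singleton (N : {set Sigma}) y : bool :=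
  if y is Some p then [forall t in N, #|[set i | pcode p i == inr t]| != 1]
  else true.

(** A merge of unsigned blocks leaves the signed blocks unchanged. *)
Lemma step_no_singleton N p s x z : step p s (inl x) z ->
  no_singleton N (Some p) -> no_singleton N (Some z).
Proof.
move=> [_ _ ez] /= /forall_inP h; apply/forall_inP=> t /h.
congr (_ != _); apply: eq_card => i; rewrite !inE ez.
case: (pcode p i) => [w|t'] //=; case: ifP => // _.
by case: (w.2).
Qed.

Lemma greedy_exists p y : (Some p : P) < y ->
  exists2 g, greedy lab (Some p : P) y g &
    forall N : {set Sigma}, sbar \notin N \/ (1 < n)%N ->
      no_singleton N (Some p) -> no_singleton N y -> no_singleton N g.
Proof.
move=> lt; have py := ltW lt.
have [/existsP[s0 hs0]|ncoh] := boolP [exists s, exists r, coherent p y r s].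
  case: (@arg_minnP _ s0 (fun s => [exists r, coherent p y r s])
    (fun s : 'I_n => s : nat) hs0) => s /existsP[r coh] smin.
  have [|g gg st] := greedy_coherent py coh.
    by move=> r' s' coh'; apply: smin; apply/existsP; exists r'.
  by exists (Some g) => // N _ hp _; apply: step_no_singleton st hp.
have {}ncoh r s : ~~ coherent p y r s.
  by move/existsPn/(_ s)/existsPn: ncoh.
case: y lt py ncoh => [q|] lt py ncoh; last first.
  have [/existsP[s rs]|nr] := boolP [exists s, is_root p s]; last first.
    exists None => //; split=> //.
    - by apply: None_covers => i; move/existsPn: nr.
    - move=> [z|] // cz; have [s [v [rs _ _]]] := covers_step cz.
      by move/existsPn: nr => /(_ s); rewrite rs.
    - by move=> w /covers_lt; rewrite lt_neqAle; case: w.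
  (* Below the maximum any two roots could be merged coherently. *)
  have suniq i : is_root p i -> i = s.
    move=> ri; case: (ltngtP i s) => [l|l|/ord_inj //].
      by have := ncoh i s; rewrite /coherent ri rs l.
    by have := ncoh s i; rewrite /coherent ri rs l.
  have [t t1 tS] := sign_pos_first sbar (signs p).
  have [g gg st] := greedy_last_root rs suniq t1.
  exists (Some g) => // N hN /= /forall_inP hp _; apply/forall_inP=> t' t'N.
  have [_ _ ez] := st; have [et|nt] := eqVneq t' t; last first.
    rewrite (_ : [set i | _] = [set i | pcode p i == inr t']) ?hp //.
    apply/setP=> i; rewrite !inE ez; case: (pcode p i) => [x|?] //=.
    case: ifP => // _; rewrite twist_inr.
    by apply/eqP=> -[e]; rewrite e eqxx in nt.
  (* Either [t] was in use, and its block gains [s] besides an earlier index; or no sign was in use,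
     [s] represents all [n] indices, and all of them receive [sbar]. The latter is harmless when
     [sbar] is exempt or [n > 1]. *)
  rewrite {}et in t'N *; case: tS => [tS|[S0 et]].
    have /existsP[i /eqP ei] : [exists i, pcode p i == inr t] by rewrite -signs_pcode.
    have si : i != s.
      by apply/eqP=> es; rewrite es in ei; case/eqP: rs; rewrite ei.
    rewrite neq_ltn; apply/orP; right; rewrite -(_ : #|[set i; s]| = 2%N).
      apply/subset_leq_card/subsetP=> j; rewrite !inE => /orP[] /eqP ->.
        by rewrite ez ei.
      by rewrite (step_pcode st).
    by rewrite cards2 si.
  rewrite (_ : [set i | _] = setT).
    rewrite cardsT card_ord neq_ltn; case: hN => [|->]; last by rewrite orbT.
    by rewrite -et t'N.
  apply/setP=> i; rewrite !inE ez; case ei: (pcode p i) => [x|t''] /=.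
    have [_ /suniq ->] := pcode_root ei; rewrite eqxx.
    by rewrite twist_inr eqxx.
  have : t'' \in signs p by rewrite signs_pcode; apply/existsP; exists i; rewrite ei.
  by rewrite S0 inE.
rewrite ltSome in lt.
pose sgn t := [exists s, is_root p s && (pcode q s == inr t)].
have [/existsP[t0 ht0]|nsgn] := boolP [exists t, sgn t].
  case: (@arg_minnP _ t0 sgn (sign_pos sbar (signs p)) ht0) => t.
  move=> /existsP[s /andP[rs /eqP eqs]] tmin.
  have [|g gg st] := greedy_sign (ltW lt) ncoh rs eqs.
    by move=> s' t' rs' e; apply: tmin; apply/existsP; exists s'; rewrite rs' e eqxx.
  exists (Some g) => // N _ /= /forall_inP hp /forall_inP hq.
  have [_ _ ez] := st; apply/forall_inP=> t' t'N.
  have [et|nt] := eqVneq t' t; last first.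
    rewrite (_ : [set i | _] = [set i | pcode p i == inr t']) ?hp //.
    apply/setP=> i; rewrite !inE ez; case: (pcode p i) => [x|?] //=.
    case: ifP => // _; rewrite twist_inr.
    by apply/eqP=> -[e]; rewrite e eqxx in nt.
  (* No root other than [s] has the sign [t] in [q], so the block of [t] is already the one in [q],
     whose size is allowed. *)
  rewrite (_ : [set i | _] = [set i | pcode q i == inr t']) ?hq //.
  apply/setP=> i; rewrite !inE ez -(le_pcode _ _ (ltW lt)) et.
  case ei: (pcode p i) => [x|?] //=; have [_ rx] := pcode_root ei.
  case: (eqVneq x.1 s) => [->|nx]; first by rewrite eqs !twist_inr.
  apply/esym/negbTE; apply: contra nx => /eqP e; apply/eqP.
  have e' : pcode q x.1 = inr t by case: (x.2) (pcode q x.1) e => -[] //= ? [->].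
  case: (ltngtP x.1 s) => [l|l|/ord_inj //].
    by have := ncoh x.1 s; rewrite /coherent rx rs l /= e' eqs eqxx.
  by have := ncoh s x.1; rewrite /coherent rx rs l /= e' eqs eqxx.
have {}nsgn s t : is_root p s -> pcode q s != inr t.
  by move=> rs; move/existsPn: nsgn => /(_ t)/existsPn/(_ s); rewrite rs.
pose nonc r := [exists s, [&& is_root p r, is_root p s, (r < s)%N
                 & compat (Some q : P) s (inl (r, true))]].
(* Some root is lost in [q]. It goes to a smaller root because signs are excluded, and with a bar
   because coherent merges are excluded. *)
have [r0 hr0] : exists r, nonc r.
  have [s [rs]] := lt_step lt; case e: (pcode q s) => [[r b]|t] /=; last first.
    by have := nsgn s t rs; rewrite e eqxx.
  case/andP=> l rr; have [_ /eqP er] := pcode_root e; rewrite /= in er.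
  exists r; apply/existsP; exists s; rewrite rr rs l /= er e /=.
  case: b e => // e; have := ncoh r s; rewrite /coherent rr rs l /= er e eqxx.
  by [].
case: (@arg_minnP _ r0 nonc (fun r : 'I_n => r : nat) hr0) => r.
move=> /existsP[s /and4P[rr rs l c]] rmin.
have [|g gg st] := greedy_noncoherent (ltW lt) ncoh nsgn rr rs l c.
  move=> r' s' rr' rs' l' c'; apply: rmin; apply/existsP; exists s'.
  by rewrite rr' rs' l'.
by exists (Some g) => // N _ hp _; apply: step_no_singleton st hp.
Qed.

End GreedySteps.

(** * The four types *)

Section Types.
Variables (n : nat) (Sigma : finType) (sbar : Sigma).

Let P := lposet n Sigma.
Implicit Types (p q : lpart n Sigma) (N : {set Sigma}).

Lemma ex_bottom : exists2 b : lpart n Sigma, forall p, b <= p &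
  forall i, pcode b i = inl (i, false).
Proof.
have [|b eb] := @decode n Sigma (fun i => inl (i, false)).
  by move=> i x [<-] /=.
by exists b => // p; apply/le_pcode => i; rewrite eb.
Qed.

Lemma greedy_lposet N (x y : P) : sbar \notin N \/ (1 < n)%N -> x < y ->
  exists2 g, greedy (label sbar) x y g &
    no_singleton N x -> no_singleton N y -> no_singleton N g.
Proof.
case: x => [p|] hN lt; last by move: lt; rewrite lt_neqAle; case: y.
by have [g gg gN] := greedy_exists sbar lt; exists g => //; apply: gN.
Qed.

Lemma EL_shellable_no_singleton (d : Order.disp_t) (Q : finPOrderType d)
    (f : Q -> P) N : sbar \notin N \/ (1 < n)%N ->
  {mono f : x y / x <= y} ->
  (forall x, no_singleton N x <-> exists x', x = f x') ->
  EL_shellable Q.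
Proof.
move=> hN fle fS.
have EL := EL_labeling_embed fle fS (fun x y => @greedy_lposet N x y hN).
apply: EL_shellable_nat EL.
have [b bmin eb] := ex_bottom.
have /fS[b' eb'] : no_singleton N (Some b : P).
  apply/forall_inP=> t _; rewrite (_ : [set i | _] = set0) ?cards0 //.
  by apply/setP=> i; rewrite !inE eb.
have /fS[t' et'] : no_singleton N (None : P) by [].
split; [exists b' | exists t'] => x; rewrite -fle.
  by rewrite -eb'; case: (f x).
by rewrite -et'; case: (f x).
Qed.

Lemma in_typeB_no_singleton (x : P) :
  in_typeB sbar x = no_singleton (~: [set sbar]) x.
Proof.
case: x => //= p; apply: eq_forallb => t; rewrite !inE sblock_card.
by congr (_ ==> _); case: #|_| => [|[|k]] //; lia.
Qed.

Lemma in_typeD_no_singleton (x : P) : in_typeD x = no_singleton setT x.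
Proof.
case: x => //= p; apply: eq_forallb => t; rewrite !inE sblock_card.
by case: #|_| => [|[|k]] //; lia.
Qed.

Lemma EL_shellable_typeB : EL_shellable (typeB n sbar).
Proof.
apply: (@EL_shellable_no_singleton _ (typeB n sbar) val (~: [set sbar])).
- by left; rewrite !inE eqxx.
- by [].
- move=> x; rewrite -in_typeB_no_singleton.
  split=> [h|[x' ->]]; [by exists (exist _ x h) | exact: (valP x')].
Qed.

Lemma EL_shellable_typeC : EL_shellable (typeC n Sigma).
Proof.
apply: (@EL_shellable_no_singleton _ (typeC n Sigma) id set0) => //.
  by left; rewrite inE.
move=> x; split=> _; first by exists x.
by case: x => //= p; apply/forall_inP=> t; rewrite inE.
Qed.

Lemma EL_shellable_typeD : (1 < n)%N -> EL_shellable (typeD n Sigma).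
Proof.
move=> n2; apply: (@EL_shellable_no_singleton _ (typeD n Sigma) val setT); first by right.
- by [].
- move=> x; rewrite -in_typeD_no_singleton.
  split=> [h|[x' ->]]; [by exists (exist _ x h) | exact: (valP x')].
Qed.

(* The poset is [\hat 0 < \hat 1], which is not a cover in type C, so the labels
   of type C do not restrict. *)
Lemma EL_shellable_typeD1 : n = 1 -> EL_shellable (typeD n Sigma).
Proof.
move=> n1; have [b bmin eb] := ex_bottom.
have eq_b p : in_typeD (Some p) -> p = b.
  rewrite in_typeD_no_singleton => /forall_inP h; apply: pcode_inj => i; rewrite eb.
  have ei j : j = i.
    have k0 (k : 'I_n) : k = 0 :> nat.
      by have := ltn_ord k; rewrite [X in (_ < X)%N]n1 ltnS leqn0 => /eqP.
    by apply: ord_inj; rewrite !k0.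
  case e: (pcode p i) => [x|t].
    by have [_ /eqP] := pcode_root e; rewrite (ei x.1) e.
  have eT : [set j | pcode p j == inr t] = setT.
    by apply/setP=> j; rewrite !inE (ei j) e eqxx.
  by have /negP[] := h t (in_setT t); rewrite eT cardsT card_ord; apply/eqP.
have bD : in_typeD (Some b : P).
  rewrite in_typeD_no_singleton; apply/forall_inP=> t _.
  rewrite (_ : [set i | _] = set0) ?cards0 //.
  by apply/setP=> i; rewrite !inE eb.
pose bot : typeD n Sigma := exist _ (Some b : P) bD.
pose top : typeD n Sigma := exist _ (None : P) isT.
have botP x : bot <= x.
  by rewrite leEsub /=; case: (val x) => [p|] //; apply: bmin.
have topP x : x <= top by rewrite leEsub /=; case: (val x).
have dich x : x = bot \/ x = top.
  case: x => -[p|] h; [left|right]; apply: val_inj => //=.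
  by rewrite (eq_b p h).
(* The only nontrivial interval is a single edge, so a constant label suffices. *)
have h (x y : typeD n Sigma) : x < y -> exists2 g,
    greedy (fun _ _ => 0) x y g & xpredT x -> xpredT y -> xpredT g.
  move=> xy; exists y => //.
  have [eb'|ey] := dich y; first by move: xy; rewrite eb' lt_leAnge botP andbF.
  have [ex|ex] := dich x; last by rewrite ey ex ltxx in xy.
  split=> //.
  - rewrite /covers xy; apply/existsPn => z.
    by have [->|->] := dich z; rewrite ?ex ?ey ltxx ?andbF.
  - move=> z /covers_lt xz _; have [ez|ez] := dich z.
      by rewrite ez ex ltxx in xz.
    by case; rewrite ez ey.
  - by move=> w /covers_lt; rewrite ey lt_leAnge topP andbF.
apply: EL_shellable_nat (EL_labeling_embed _ _ h) => //.
  by split; [exists bot | exists top].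
by move=> x; split=> // _; exists x.
Qed.

Lemma EL_shellable_typeA : (1 <= n)%N -> EL_shellable (typeA n Sigma).
Proof.
move=> n1.
pose S (x : P) := if x is Some p then in_typeA p else false.
pose f (x : typeA n Sigma) : P := Some (val x).
have fle : {mono f : x y / x <= y} by [].
have fS x : S x <-> exists x', x = f x'.
  split; last by move=> [x' ->]; apply: (valP x').
  by case: x => // p h; exists (exist _ p h).
(* Type A is a lower set, because no element of type A lies above one with a sign or a barred
   representative. So greedy covers below [y] stay in it. *)
have Sdown x y : x <= y -> S y -> S x.
  case: x y => [p|] [q|] //= /le_pcode pq /in_typeA_pcode hq.
  apply/in_typeA_pcode => i; have := pq i; have [r ->] := hq i.
  case: (pcode p i) => [[j b]|t] //=; have [r' ->] := hq j.
  by case: b => //= _; exists j.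
have h (x y : P) : x < y -> exists2 g,
    greedy (label sbar) x y g & S x -> S y -> S g.
  move=> xy; have [|g gg _] := @greedy_lposet set0 x y _ xy; first by left; rewrite inE.
  by exists g => // _; case: gg => _ gy _ _; apply: Sdown.
apply: EL_shellable_nat (EL_labeling_embed fle fS h).
have [b bmin eb] := ex_bottom.
have bA : in_typeA b by apply/in_typeA_pcode => i; exists i; rewrite eb.
(* The maximum of type A has the two blocks [[n]] and its bar, represented by the least index
   [Ordinal n1]. *)
have [|t et] := @decode n Sigma (fun i => inl (Ordinal n1, false)).
  by move=> i x [<-].
have tA : in_typeA t by apply/in_typeA_pcode => i; exists (Ordinal n1); rewrite et.
split; [exists (exist _ b bA) | exists (exist _ t tA)] => x; rewrite leEsub /=.
  exact: bmin.
apply/le_pcode => i; have /in_typeA_pcode/(_ i)[r ->] := valP x.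
by rewrite /= !et.
Qed.

End Types.

Theorem theorem4p3 (n : nat) (Sigma : finType) (sbar : Sigma) :
  (1 <= n)%N ->
  [/\ EL_shellable (typeA n Sigma),
      EL_shellable (typeB n sbar),
      EL_shellable (typeC n Sigma)
    & EL_shellable (typeD n Sigma)].
Proof.
move=> n1; split.
- exact: EL_shellable_typeA.
- exact: EL_shellable_typeB.
- exact: EL_shellable_typeC.
- move: n1; rewrite leq_eqVlt => /predU1P[/esym|]; first exact: EL_shellable_typeD1.
  exact: EL_shellable_typeD.
Qed.
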